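(* Assume (A1) and (A2). Let $(t_0,x_0)\in\Omega$ be a singular point of the Hopf-type formula $u(t,x)=\max_{q\in\mathbb R^n}\{\langle x,q\rangle-\sigma^*(q)-\int_0^tH(\tau,q)\,d\tau\}$. Then for each $\epsilon>0$ there exists $\delta>0$ such that for any $t_*>t_0$ with $|t_*-t_0|\le\delta$ there exists $x_*\in B'(x_0,\epsilon)$ such that $(t_*,x_* )$ is also a singular point of $u$.
   Context: Let $T>0$ and $\Omega=(0,T)\times\mathbb R^n$. Let $H=H(t,p)$ be a real-valued function of class $C^1$ on $[0,T]\times\mathbb R^n$ and $\sigma:\mathbb R^n\to\mathbb R$ be convex and of class $C^1$. $\sigma^*:\mathbb R^n\to\mathbb R\cup\{+\infty\}$ is the Fenchel conjugate of $\sigma$. $B'(x_0,r)$ is the closed ball centered at $x_0$ with radius $r$. Condition (A1): for every $(t_0,x_0)\in[0,T)\times\mathbb R^n$ there exist positive constants $r$ and $N$ such that $$\langle x,p\rangle-\sigma^*(p)-\int_0^tH(\tau,p)\,d\tau<\max_{|q|\le N}\Big\{\langle x,q\rangle-\sigma^*(q)-\int_0^tH(\tau,q)\,d\tau\Big\}$$ whenever $(t,x)\in[0,T)\times\mathbb R^n$, $|t-t_0|+|x-x_0|<r$ and $|p|>N$. Condition (A2): $H$ has one of the two following forms: a) $H(t,\cdot)$ is convex for all $t\in(0,T)$, or $H(t,\cdot)$ is concave for all $t\in(0,T)$; b) $H(t,p)=g(t)h(p)+k(t)$ for some functions $g,h,k$, where $g(t)$ does not change its sign on $(0,T)$. A point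 $(t,x)\in\Omega$ is singular for $u$ if $u$ is not differentiable (jointly in $(t,x)$) at this point; otherwise it is regular. *)

(* Defs.v *)
From HB Require Import structures.
From mathcomp Require Import all_boot all_order all_algebra.
From mathcomp Require Import all_classical all_reals all_analysis.

Set Implicit Arguments.
Unset Strict Implicit.
Unset Printing Implicit Defensive.

Import Order.TTheory GRing.Theory Num.Theory.
Import numFieldNormedType.Exports.

Local Open Scope classical_set_scope.
Local Open Scope ring_scope.

Definition dot {R : realType} {n : nat} (x y : 'rV[R]_n) : R :=
  \sum_(i < n) x 0 i * y 0 i.

(* Euclidean norm: the library norm `|x| on 'rV[R]_n is the sup norm. *)
Definition enorm {R : realType} {n : nat} (x : 'rV[R]_n) : R :=
  Num.sqrt (dot x x).

(* f is C^1 on A: it has at each point of A a derivative relative to A that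
   depends continuously on the point.  A need not be open, so one-sided
   derivatives are used at boundary points.  Only meant for V of finite
   dimension, where a linear form is continuous and pointwise continuity of D
   is continuity in operator norm. *)
Definition C1_on {R : realType} {V : normedModType R} (A : set V) (f : V -> R) :=
  exists D : V -> {linear V -> R^o},
    (forall z, A z -> forall e : R, 0 < e ->
       \forall w \near within A (nbhs z),
         `|f w - f z - D z (w - z)| <= e * `|w - z|) /\
    (forall v, {within A, continuous (fun z => D z v : R)}).

Definition fenchel {R : realType} {n : nat} (sigma : 'rV[R]_n -> R)
    (p : 'rV[R]_n) : \bar R :=
  ereal_sup (range (fun x => (dot x p - sigma x)%:E)).

(* The greatest element of A if A has one, and -oo otherwise; in particular
   a < emax A implies that the maximum is attained. *)
Definition emax {R : realType} (A : set (\bar R)) : \bar R :=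
  xget -oo%E [set m | A m /\ forall a, A a -> (a <= m)%E].

Definition phi {R : realType} {n : nat} (sigma : 'rV[R]_n -> R)
    (H : R -> 'rV[R]_n -> R) (t : R) (x q : 'rV[R]_n) : \bar R :=
  ((dot x q)%:E - fenchel sigma q
    - (\int[lebesgue_measure]_(tau in `[0, t]) H tau q)%:E)%E.

Definition hopf {R : realType} {n : nat} (sigma : 'rV[R]_n -> R)
    (H : R -> 'rV[R]_n -> R) (t : R) (x : 'rV[R]_n) : R :=
  fine (emax [set phi sigma H t x q | q in [set: 'rV[R]_n]]).

Definition condA1 {R : realType} {n : nat} (T : R) (sigma : 'rV[R]_n -> R)
    (H : R -> 'rV[R]_n -> R) :=
  forall (t0 : R) (x0 : 'rV[R]_n), 0 <= t0 < T ->
  exists r N : R, [/\ 0 < r, 0 < N &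
    forall (t : R) (x p : 'rV[R]_n), 0 <= t < T ->
      `|t - t0| + enorm (x - x0) < r -> N < enorm p ->
      (phi sigma H t x p <
        emax [set phi sigma H t x q | q in [set q | (enorm q <= N)%R]])%E].

Definition condA2 {R : realType} {n : nat} (T : R) (H : R -> 'rV[R]_n -> R) :=
  [\/ forall t, 0 < t < T -> convex_function [set: 'rV[R]_n] (H t),
      forall t, 0 < t < T ->
        convex_function [set: 'rV[R]_n] (fun p => - H t p) |
      exists (g : R -> R) (h : 'rV[R]_n -> R) (k : R -> R),
        (forall t p, 0 < t < T -> H t p = g t * h p + k t) /\
        ((forall t, 0 < t < T -> 0 <= g t) \/
         (forall t, 0 < t < T -> g t <= 0))].

Definition singular {R : realType} {n : nat} (T : R) (u : R -> 'rV[R]_n -> R)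
    (t : R) (x : 'rV[R]_n) :=
  0 < t < T /\
  ~ differentiable (fun z : R * 'rV[R]_n => u z.1 z.2) (t, x).

(* Main.v *)
(* Let l(t, x) be the set of maximisers q in the formula for u(t, x). Under (A1)
   l(t, x) is nonempty and locally bounded, u(t, .) is convex, l(t, x) consists
   of subgradients of u(t, .) at x, and u is differentiable at (t, x) as soon as
   l(t, x) is a singleton.

   Suppose l(ts, x) = {p} and follow the characteristic backward from x, to
   x(t) = x - \int_t^ts H_p(tau, p) dtau. With y = x(0), the loss
   incurred at (t, x(t)) by choosing q instead of p is
     sigma^*(q) - sigma^*(p) - <y, q - p>
       + \int_0^t (H(tau, q) - H(tau, p) - <H_p(tau, p), q - p>) dtau.
   By (A2) the integrand has a constant sign in tau, so the loss lies between
   its values at t = 0 and t = ts. These are positive for q <> p, the former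
   because sigma is differentiable. Hence l(t, x(t)) = {p} for all t <= ts.

   It remains to find, for ts slightly larger than t0, a point x near x0 and a
   subgradient p of u(ts, .) at x whose backward characteristic reaches x0 at
   time t0: were u differentiable at (ts, x), then l(ts, x) = {p}, so
   l(t0, x0) = {p} and (t0, x0) would be regular. Minimising over p
     sup_{|z - x0| <= rho} (<z, p> - u(ts, z))
       - \int_t0^ts H(tau, p) dtau - <x0, p>
   yields such a p, with x = x0 + \int_t0^ts H_p(tau, p) dtau. *)

From HB Require Import structures.
Require Import Defs.
From mathcomp Require Import all_boot all_order all_algebra.
From mathcomp Require Import all_classical all_reals all_analysis.
From mathcomp Require Import ring lra.
Import Order.TTheory GRing.Theory Num.Theory.
Import numFieldNormedType.Exports.
Local Open Scope classical_set_scope.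
Local Open Scope ring_scope.

(** * Dot product, sup norm and Euclidean norm on row vectors *)

Section Dot.
Context {R : realType} {n : nat}.
Implicit Types x y z : 'rV[R]_n.

Lemma dotC x y : dot x y = dot y x.
Proof. by apply: eq_bigr => i _; rewrite mulrC. Qed.

Lemma dotDl x y z : dot (x + y) z = dot x z + dot y z.
Proof. by rewrite -big_split; apply: eq_bigr => i _; rewrite !mxE mulrDl. Qed.

Lemma dotZl (a : R) x y : dot (a *: x) y = a * dot x y.
Proof. by rewrite big_distrr; apply: eq_bigr => i _; rewrite !mxE /= mulrA. Qed.

Lemma dotDr x y z : dot x (y + z) = dot x y + dot x z.
Proof. by rewrite dotC dotDl !(dotC x). Qed.

Lemma dotZr (a : R) x y : dot x (a *: y) = a * dot x y.
Proof. by rewrite dotC dotZl dotC. Qed.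

Lemma dotNl x y : dot (- x) y = - dot x y.
Proof. by rewrite -scaleN1r dotZl mulN1r. Qed.

Lemma dotNr x y : dot x (- y) = - dot x y.
Proof. by rewrite dotC dotNl dotC. Qed.

Definition dotE := (dotDl, dotDr, dotNl, dotNr, dotZl, dotZr).

Lemma coord_le_norm x i : `|x 0 i| <= `|x|.
Proof. by rewrite [leRHS]/Num.norm/= mx_normrE (le_bigmax _ _ (0, i)). Qed.

Lemma norm_le_coords x (a : R) :
  0 <= a -> (forall i, `|x 0 i| <= a) -> `|x| <= a.
Proof.
move=> a0 xa; rewrite [leLHS]/Num.norm/= mx_normrE; apply/bigmax_leP.
by split => // -[i j] _ /=; rewrite (ord1 i).
Qed.

Lemma dot_le x y : `|dot x y| <= n%:R * `|x| * `|y|.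
Proof.
apply: (le_trans (ler_norm_sum _ _ _)).
apply: (@le_trans _ _ (\sum_(i < n) `|x| * `|y|)).
  by apply: ler_sum => i _; rewrite normrM ler_pM ?coord_le_norm.
by rewrite sumr_const card_ord -[leLHS]mulr_natl mulrA.
Qed.

Lemma enorm_le x : enorm x <= n%:R * `|x|.
Proof.
rewrite -(ger0_norm (mulr_ge0 (ler0n R n) (normr_ge0 x))) -sqrtr_sqr.
apply: ler_wsqrtr; apply: (le_trans (ler_norm _)).
apply: (le_trans (dot_le x x)); rewrite exprMn -mulrA -expr2 ler_wpM2r ?sqr_ge0//.
by rewrite -natrX ler_nat; case: (n) => // m; rewrite leq_pmulr.
Qed.

Lemma dot0l x : dot 0 x = 0.
Proof. by rewrite /dot big1// => i _; rewrite mxE mul0r. Qed.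

Lemma enorm0 : enorm (0 : 'rV[R]_n) = 0.
Proof. by rewrite /enorm dot0l sqrtr0. Qed.

Lemma norm_le_enorm x : `|x| <= enorm x.
Proof.
apply: norm_le_coords; first exact: sqrtr_ge0.
move=> i; rewrite -sqrtr_sqr; apply: ler_wsqrtr.
rewrite [leRHS]/dot (bigD1 i)//= expr2 lerDl.
by apply: sumr_ge0 => j _; rewrite -expr2 sqr_ge0.
Qed.

(** Pairing [x] with its sign vector gives the sum of the absolute coordinates, which dominates the
    sup norm. *)
Lemma norm_attained x : exists2 v : 'rV[R]_n, `|v| <= 1 & `|x| <= dot v x.
Proof.
exists (\row_i Num.sg (x 0 i)).
  by apply: norm_le_coords => // i; rewrite mxE normr_sg lern1 leq_b1.
have sgE i : (\row_i Num.sg (x 0 i)) 0 i * x 0 i = `|x 0 i|.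
  by rewrite mxE -normrEsg.
apply: norm_le_coords => [|i]; rewrite /dot.
  by apply: sumr_ge0 => i _; rewrite sgE.
by rewrite (bigD1 i)//= sgE lerDl sumr_ge0// => j _; rewrite sgE.
Qed.

Lemma linear_dot (f : {linear 'rV[R]_n -> R^o}) v :
  f v = dot v (\row_i f (delta_mx 0 i)).
Proof.
rewrite [in LHS](row_sum_delta v) linear_sum; apply: eq_bigr => i _.
by rewrite linearZ mxE.
Qed.

Lemma dot_eqP x y : (forall v, dot v x = dot v y) -> x = y.
Proof.
move=> xy; apply/rowP => i; have := xy (delta_mx 0 i).
rewrite /dot (bigD1 i)//= [in RHS](bigD1 i)//= !mxE !eqxx !mul1r.
by rewrite !big1 ?addr0// => j ji; rewrite mxE (negbTE ji) andbF mul0r.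
Qed.

Lemma norm_ball_compact (x : 'rV[R]_n) (r : R) :
  compact [set y : 'rV[R]_n | `|y - x| <= r].
Proof.
apply: bounded_closed_compact.
  exists (r + `|x|); split; first exact: num_real.
  move=> M ltM y /= yx; rewrite -(subrK x y) (le_trans (ler_normD _ _))//.
  by rewrite (le_trans _ (ltW ltM))// lerD2r.
apply: (@closed_comp _ _ (fun y : 'rV[R]_n => `|y - x|) [set z | z <= r]).
  move=> y _; exact: (cvg_norm (cvgB cvg_id (cvg_cst _))).
exact: closed_le.
Qed.

Lemma cvg_dot (T : Type) (F : set_system T) {FF : Filter F} (f g : T -> 'rV[R]_n)
    (a b : 'rV[R]_n) :
  f @ F --> a -> g @ F --> b -> (fun w => dot (f w) (g w)) @ F --> dot a b.
Proof.
move=> fa gb; apply: cvg_big => [|i _]; first exact: add_continuous.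
have ci (c : 'rV[R]_n) : (fun M : 'rV[R]_n => M 0 i) @ c --> c 0 i.
  exact: coord_continuous.
by apply: cvgM; [exact: (cvg_comp f _ fa (ci a))|exact: (cvg_comp g _ gb (ci b))].
Qed.

End Dot.

(** * Convexity along segments and one-sided derivatives *)

Lemma convexP {R : realType} {E : lmodType R} (f : E -> R) :
  convex_function [set: E] f ->
  forall (x y : E) (s : R), 0 <= s <= 1 ->
    f (x + s *: (y - x)) <= f x + s * (f y - f x).
Proof.
move=> cf x y s /andP[s0 s1].
have := cf (Itv01 s0 s1) y x; rewrite !inE => /(_ I I).
rewrite convRE {1}/conv /= => fle.
have -> : x + s *: (y - x) = s *: y + (1 - s) *: x.
  by rewrite scalerBr scalerBl scale1r addrC -addrA [- _ + x]addrC.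
by rewrite (le_trans fle)// /unstable.onem; lra.
Qed.

Lemma divr_mulr_le {R : realType} (e a : R) :
  0 < e -> 0 <= a -> 0 < e / (a + 1) /\ e / (a + 1) * a <= e.
Proof.
move=> e0 a0; have a1 : 0 < a + 1 by rewrite ltr_wpDl.
by rewrite divr_gt0//; split=> //; rewrite mulrAC ler_pdivrMr// ler_pM2l// lerDl.
Qed.

(** Right derivative of [g] at 0, written without a quotient. It is one-sided because it is compared
    with inequalities on segments [p + s *: (q - p)], which hold for [0 <= s <= 1]. *)
Definition rderiv {R : realType} (g : R -> R) (d : R) :=
  forall e, 0 < e -> \forall s \near 0^'+, `|g s - g 0 - s * d| <= e * s.

Section Rderiv.
Context {R : realType}.
Implicit Types (g h : R -> R) (a b d e s : R).

Lemma rderiv_le g d a : rderiv g d ->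
  (\forall s \near 0^'+, g s - g 0 <= s * a) -> d <= a.
Proof.
move=> gd ga; rewrite leNgt; apply/negP => ad.
have e0 : 0 < (d - a) / 2 by lra.
near (0 : R)^'+ => s.
have s0 : 0 < s by [].
have : `|g s - g 0 - s * d| <= (d - a) / 2 * s by near: s; exact: gd.
have : g s - g 0 <= s * a by near: s.
by rewrite ler_norml; nra.
Unshelve. all: by end_near. Qed.

Lemma rderivN g d : rderiv g d -> rderiv (fun s => - g s) (- d).
Proof.
move=> gd e e0; apply: filterS (gd e e0) => s.
by rewrite -normrN; congr (`|_| <= _); ring.
Qed.

Lemma rderivD g h d e : rderiv g d -> rderiv h e ->
  rderiv (fun s => g s + h s) (d + e).
Proof.
move=> gd he c c0; have c20 : 0 < c / 2 by lra.
apply: filterS2 (gd _ c20) (he _ c20) => s.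
by rewrite !ler_norml => /andP[? ?] /andP[? ?]; apply/andP; split; lra.
Qed.

Lemma rderiv_ge g d a : rderiv g d ->
  (\forall s \near 0^'+, s * a <= g s - g 0) -> a <= d.
Proof.
move=> gd ga; rewrite -lerN2; apply: rderiv_le (rderivN _ _ gd) _.
by apply: filterS ga => s; lra.
Qed.

Lemma rderiv_uniq g a b :
  rderiv g a -> rderiv g b -> a = b.
Proof.
move=> ga gb; apply/eqP; rewrite eq_le; apply/andP; split.
  rewrite -subr_le0; apply: rderiv_le (rderivD _ _ _ _ ga (rderivN _ _ gb)) _.
  by near=> s; rewrite !subrr mulr0.
rewrite -subr_le0; apply: rderiv_le (rderivD _ _ _ _ gb (rderivN _ _ ga)) _.
by near=> s; rewrite !subrr mulr0.
Unshelve. all: by end_near. Qed.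

Lemma rderivZ g (c : R) d :
  rderiv g d -> rderiv (fun s => c * g s) (c * d).
Proof.
move=> gd e e0; have [e1 ec] := divr_mulr_le e _ e0 (normr_ge0 c).
near=> s; have s0 : 0 < s by [].
have : `|g s - g 0 - s * d| <= e / (`|c| + 1) * s by near: s; exact: gd.
have -> : c * g s - c * g 0 - s * (c * d) = c * (g s - g 0 - s * d) by ring.
rewrite normrM => h; apply: (le_trans (ler_wpM2l (normr_ge0 c) h)).
by rewrite mulrA ler_pM2r// mulrC.
Unshelve. all: by end_near. Qed.

Lemma rderivC (c : R) : rderiv (fun=> c) 0.
Proof.
move=> e e0; near=> s; have s0 : 0 < s by [].
by rewrite mulr0 !subrr normr0 mulr_ge0 ?ltW.
Unshelve. all: by end_near. Qed.

End Rderiv.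

Lemma near_dist {R : realType} {V : normedModType R} (x : V) (e : R) : 0 < e ->
  \forall y \near x, `|y - x| < e.
Proof.
move=> e0; apply/nbhs_ballP; exists e => //= y.
by rewrite -ball_normE /= distrC.
Qed.

Lemma near_line {R : realType} {V : normedModType R} (x v : V) (P : set V) :
  (\forall y \near x, P y) -> \forall s \near (0 : R), P (x + s *: v).
Proof.
suff : (x + s *: v) @[s --> (0 : R)] --> x by exact.
rewrite -[X in _ --> X]addr0 -[X in _ --> _ + X](scale0r v).
by apply: cvgD; [exact: cvg_cst|apply: cvgZr_tmp; exact: cvg_id].
Qed.

Lemma near0_line {R : realType} {V : normedModType R} (x v : V) (P : set V) :
  (\forall y \near x, P y) -> \forall s \near (0 : R)^'+, P (x + s *: v).
Proof. by move=> xP; apply: cvg_within; exact: near_line. Qed.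

Lemma C1_on_gradient {R : realType} {n : nat} (f : 'rV[R]_n -> R) :
  C1_on [set: 'rV[R]_n] f ->
  forall y, exists G, forall v, rderiv (fun s => f (y + s *: v)) (dot v G).
Proof.
move=> [D [Df _]] y; exists (\row_i D y (delta_mx 0 i)) => v e e0.
rewrite -linear_dot.
have [e1 ev] := divr_mulr_le e _ e0 (normr_ge0 v).
have := Df y I _ e1; rewrite near_withinE => /(near0_line _ v).
apply: filter_app; near=> s.
have s0 : 0 < s by [].
rewrite scale0r addr0 [y + _ - y]addrAC subrr add0r linearZ => /(_ I) /le_trans; apply.
by rewrite normrZ (gtr0_norm s0) mulrCA mulrC ler_wpM2r// ltW.
Unshelve. all: by end_near. Qed.

(** * Fenchel conjugates and their subgradients *)

Section Fenchel.
Context {R : realType} {n : nat}.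
Implicit Types (sigma : 'rV[R]_n -> R) (x y p q : 'rV[R]_n) (a b : R).

Lemma fenchel_leP sigma q a :
  (fenchel sigma q <= a%:E)%E <-> forall x, dot x q - sigma x <= a.
Proof.
split=> [qa x|qa].
  rewrite -lee_fin; apply: le_trans qa; apply: ereal_sup_ubound.
  by exists x.
by apply: ge_ereal_sup => _ [x _ <-]; rewrite lee_fin.
Qed.

Lemma fenchel_ge sigma q x : ((dot x q - sigma x)%:E <= fenchel sigma q)%E.
Proof. by apply: ereal_sup_ubound; exists x. Qed.

Lemma fenchel_case sigma q :
  fenchel sigma q = +oo%E \/ exists a, fenchel sigma q = a%:E.
Proof.
have := fenchel_ge sigma q 0.
by case: (fenchel sigma q) => [a| |] // _; [right; exists a|left].
Qed.

Lemma fenchel_convex sigma p q a b s : 0 <= s <= 1 ->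
  fenchel sigma p = a%:E -> fenchel sigma q = b%:E ->
  exists2 c, fenchel sigma (p + s *: (q - p)) = c%:E & c <= a + s * (b - a).
Proof.
move=> /andP[s0 s1] pa qb.
have : (fenchel sigma (p + s *: (q - p)) <= (a + s * (b - a))%:E)%E.
  apply/fenchel_leP => x.
  have /fenchel_leP/(_ x) pa' : (fenchel sigma p <= a%:E)%E by rewrite pa.
  have /fenchel_leP/(_ x) qb' : (fenchel sigma q <= b%:E)%E by rewrite qb.
  by rewrite !dotE; nra.
have [->|[c ->]] := fenchel_case sigma (p + s *: (q - p)); first by [].
by rewrite lee_fin => ?; exists c.
Qed.

(* The strict convexity of sigma^* that is dual to the differentiability of
   sigma: subgradients at distinct points are distinct. *)
Lemma fenchel_subgrad_uniq sigma y G p a :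
  convex_function [set: 'rV[R]_n] sigma ->
  (forall v, rderiv (fun s => sigma (y + s *: v)) (dot v G)) ->
  fenchel sigma p = a%:E ->
  (forall q b, fenchel sigma q = b%:E -> a + dot y (q - p) <= b) -> p = G.
Proof.
move=> cs dG pa ysub.
(* Convexity keeps [sigma] above its tangent at [y], so the supremum defining [sigma^*(G)] is
   attained at [y]. *)
have above z : dot (z - y) G <= sigma z - sigma y.
  apply: rderiv_le (dG (z - y)) _; near=> s.
  have s01 : 0 <= s <= 1 by rewrite ltW//=; near: s; exact: nbhs_right_le.
  by have := convexP _ cs y z s s01; rewrite scale0r addr0; lra.
have fG : fenchel sigma G = (dot y G - sigma y)%:E.
  apply/eqP; rewrite eq_le fenchel_ge andbT; apply/fenchel_leP => z.
  by have := above z; rewrite !dotE; lra.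
(* Tested at [G], the hypothesis becomes the equality case of Fenchel's inequality,
   [a + sigma y <= <y, p>]: so [p] is a subgradient of [sigma] at [y]. *)
have := ysub _ _ fG; rewrite dotE dotE => ay.
have below v : dot v p <= dot v G.
  apply: rderiv_ge (dG v) _; near=> s.
  have /fenchel_leP/(_ (y + s *: v)) : (fenchel sigma p <= a%:E)%E by rewrite pa.
  by rewrite scale0r addr0 !dotE; lra.
apply: dot_eqP => v; apply/eqP; rewrite eq_le below /=.
by have := below (- v); rewrite !dotE lerN2.
Unshelve. all: by end_near. Qed.

End Fenchel.

(** * Maximisers in the Hopf formula and condition (A1) *)

Section Maximizers.
Context {R : realType} {n : nat}.
Variables (sigma : 'rV[R]_n -> R) (H : R -> 'rV[R]_n -> R).
Implicit Types (x y p q : 'rV[R]_n) (a b t : R).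

Definition intH t q : R := \int[lebesgue_measure]_(tau in `[0, t]) H tau q.

(** Stated with real numbers only: where [sigma^*] is infinite, [phi] is [-oo] and [q] cannot
    compete. *)
Definition is_max t x p := exists2 a, fenchel sigma p = a%:E &
  forall q b, fenchel sigma q = b%:E ->
    dot x q - b - intH t q <= dot x p - a - intH t p.

Lemma phiE t x q a : fenchel sigma q = a%:E ->
  phi sigma H t x q = (dot x q - a - intH t q)%:E.
Proof. by move=> qa; rewrite /phi qa. Qed.

Lemma is_max_phi t x p q : is_max t x p ->
  (phi sigma H t x q <= phi sigma H t x p)%E.
Proof.
move=> [a pa pmax]; rewrite (phiE _ _ _ _ pa).
have [qoo|[b qb]] := fenchel_case sigma q; first by rewrite /phi qoo leNye.
by rewrite (phiE _ _ _ _ qb) lee_fin pmax.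
Qed.

Lemma phi_is_max t x p : (-oo < phi sigma H t x p)%E ->
  (forall q, (phi sigma H t x q <= phi sigma H t x p)%E) -> is_max t x p.
Proof.
have [poo|[a pa]] := fenchel_case sigma p; first by rewrite /phi poo.
move=> _ pmax; exists a => // q b qb.
by have := pmax q; rewrite (phiE _ _ _ _ qb) (phiE _ _ _ _ pa) lee_fin.
Qed.

Lemma hopf_is_max t x p a : is_max t x p -> fenchel sigma p = a%:E ->
  hopf sigma H t x = dot x p - a - intH t p.
Proof.
move=> xp pa; have pmax q := is_max_phi _ _ _ q xp.
rewrite /hopf; suff -> : emax [set phi sigma H t x q | q in [set: 'rV[R]_n]] =
    phi sigma H t x p by rewrite (phiE _ _ _ _ pa).
apply: xget_unique => [|m [[q _ <-] qmax]].
  by split=> [|_ [q _ <-]]; [exists p|exact: pmax].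
apply/eqP; rewrite eq_le pmax/=.
by apply: qmax; exists p.
Qed.

Lemma hopf_ge t x p q b : is_max t x p -> fenchel sigma q = b%:E ->
  dot x q - b - intH t q <= hopf sigma H t x.
Proof.
by move=> /[dup] pmax [a pa qp] qb; rewrite (hopf_is_max _ _ _ _ pmax pa) qp.
Qed.

(** The strict inequality in (A1) excludes the default [-oo] of [emax], so the maximum over the ball
    is attained. Every vector outside the ball lies strictly below it, hence this maximum is global
    and no maximiser lies outside. *)
Lemma condA1_is_max T t0 x0 : condA1 T sigma H -> 0 <= t0 < T ->
  exists2 r, 0 < r & exists2 N, 0 < N &
  forall t x, 0 <= t < T -> `|t - t0| + enorm (x - x0) < r ->
    (exists p, is_max t x p) /\ forall p, is_max t x p -> enorm p <= N.
Proof.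
move=> hA1 /(hA1 t0 x0) [r [N [r0 N0 hN]]]; exists r => //; exists N => // t x tT tx.
have far p : N < enorm p -> exists2 q,
    (forall q', (phi sigma H t x q' <= phi sigma H t x q)%E) &
    (phi sigma H t x p < phi sigma H t x q)%E.
  move=> Np; have := hN _ _ _ tT tx; rewrite /emax.
  case: xgetP => [_ -> [[q _ <-] qmax]|_ /(_ p Np)]; last by rewrite ltNge leNye.
  move=> lt_q; exists q; last exact: lt_q.
  move=> q'; have [q'N|/lt_q/ltW//] := leP (enorm q') N.
  by apply: qmax; exists q'.
split; last first.
  move=> p xp; rewrite leNgt; apply/negP => /far [q _].
  by rewrite ltNge is_max_phi.
(* For [n = 0] there is no vector longer than [N] to feed into (A1); the maximiser is then the only
   point of the space. *)
case: (posnP n) => [n0|n0].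
  have eq0 (q : 'rV[R]_n) : q = 0.
    by apply/rowP => i; move: (ltn_ord i); rewrite {2}n0.
  have dot0 (y z : 'rV[R]_n) : dot y z = 0.
    by rewrite /dot big1// => i; move: (ltn_ord i); rewrite {2}n0.
  have f0 : fenchel sigma 0 = (- sigma 0)%:E.
    apply/eqP; rewrite eq_le; apply/andP; split.
      by apply/fenchel_leP => z; rewrite dot0 add0r (eq0 z).
    by have := fenchel_ge sigma 0 0; rewrite dot0 add0r.
  exists 0; exists (- sigma 0) => // q b; rewrite (eq0 q) f0 => -[<-].
  by rewrite lexx.
have [p Np] : exists p : 'rV[R]_n, N < enorm p.
  exists (const_mx (N + 1)); apply: (@lt_le_trans _ _ `|(N + 1)|).
    by rewrite ger0_norm ?ltrDl// addr_ge0 ?ltW.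
  apply: le_trans (norm_le_enorm _).
  by have := coord_le_norm (const_mx (N + 1)) (Ordinal n0); rewrite mxE.
have [q qmax pq] := far p Np; exists q; apply: phi_is_max => //.
exact: le_lt_trans (leNye _) pq.
Qed.

End Maximizers.

(** * Criteria for derivatives and continuity *)

Lemma is_derive_of_le {R : realType} (g : R -> R) (s d : R) :
  (forall e, 0 < e -> \forall h \near 0, `|g (s + h) - g s - h * d| <= e * `|h|) ->
  is_derive s 1 g d.
Proof.
move=> gd.
have cv : h^-1 *: ((g \o shift s) (h *: 1) - g s) @[h --> 0^'] --> d.
  apply/cvgrPdist_le => e e0; near=> h.
  have h0 : h != 0 by near: h; exact: nbhs_dnbhs_neq.
  have hp : 0 < `|h| by rewrite normr_gt0.
  have : `|g (s + h) - g s - h * d| <= e * `|h|.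
    by near: h; apply: cvg_within; exact: gd.
  rewrite /= -[h%:A]/(h * 1) mulr1 -[_ *: _]/(_ * _) addrC => gh.
  rewrite -(ler_pM2r hp) -normrM mulrBl mulrAC mulVf// mul1r -normrN opprB.
  by rewrite addrC [h + s]addrC in gh *; rewrite [d * h]mulrC.
by split; [exact: cvgP cv|exact: cvg_lim cv].
Unshelve. all: by end_near. Qed.

(** Meant for a retraction [g] onto [A]: continuity on the closed strip becomes continuity
    everywhere. *)
Lemma continuous_comp_within {S U W : topologicalType} (A : set U)
    (f : U -> W) (g : S -> U) :
  {within A, continuous f} -> continuous g -> (forall s, A (g s)) ->
  continuous (f \o g).
Proof.
move=> /subspace_continuousP cf cg Ag s.
apply: cvg_comp (cf _ (Ag s)) => P; rewrite /within /= => AP.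
have := cg s _ AP; rewrite /nbhs /= => sP.
by apply: filterS sP => u /(_ (Ag u)).
Qed.

(** * Integrals of continuous functions over segments *)

Section Rint.
Context {R : realType}.
Local Notation mu := (@lebesgue_measure R).
Implicit Types (f g : R -> R) (a b c e : R).

Lemma continuous_integrable f a b : continuous f ->
  mu.-integrable `[a, b] (EFin \o f).
Proof.
move=> cf; apply: continuous_compact_integrable; first exact: segment_compact.
exact: continuous_subspaceT.
Qed.

Lemma Rint_itv_cst a b c : a <= b -> \int[mu]_(x in `[a, b]) c = c * (b - a).
Proof.
move=> ab; rewrite Rintegral_cst//= lebesgue_measure_itv /= lte_fin.
by have [//|] := ltP a b => ba; rewrite (@le_anti _ _ a b) ?ab ?ba// subrr.
Qed.

Lemma Rint_bound f a b e : a <= b -> continuous f ->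
  (forall x, a <= x <= b -> `|f x| <= e) ->
  `|\int[mu]_(x in `[a, b]) f x| <= e * (b - a).
Proof.
move=> ab cf fe; rewrite -Rint_itv_cst//.
apply: (@le_trans _ _ (\int[mu]_(x in `[a, b]) `|f x|)).
  by apply: le_normr_Rintegral => //; exact: continuous_integrable.
apply: le_Rintegral => //.
- by apply: continuous_integrable => x; apply: cvg_norm; exact: cf.
- by apply: continuous_integrable => x; exact: cvg_cst.
Qed.

Lemma Rint_chasles f a b c : continuous f -> a <= b -> b <= c ->
  \int[mu]_(x in `[a, c]) f x - \int[mu]_(x in `[a, b]) f x =
  \int[mu]_(x in `[b, c]) f x.
Proof.
move=> cf ab bc; rewrite Rintegral_itvB ?bnd_simp//; last exact: continuous_integrable.
rewrite Rintegral_itv_obnd_cbnd//.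
apply: integrableS (continuous_integrable _ b c cf) => //.
by apply: subset_itvr; rewrite bnd_simp.
Qed.

Lemma Rint_sum (I : Type) (r : seq I) (F : I -> R -> R) a b :
  (forall i, continuous (F i)) ->
  \int[mu]_(x in `[a, b]) (\sum_(i <- r) F i x) =
  \sum_(i <- r) \int[mu]_(x in `[a, b]) F i x.
Proof.
move=> cF; have cs (s : seq I) : continuous (fun x => \sum_(i <- s) F i x).
  move=> x; apply: cvg_big => [|i _]; first exact: add_continuous.
  exact: cF.
elim: r => [|i r IH].
  rewrite big_nil (_ : (fun x => _) = cst 0); last first.
    by apply/funext => x; rewrite big_nil.
  by rewrite Rintegral_cst//= mul0r.
rewrite big_cons -IH -RintegralD//; do 1?exact: continuous_integrable.
by congr (\int[mu]_(x in _) _); apply/funext => x; rewrite big_cons.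
Qed.

End Rint.

Lemma near_fst {T U : topologicalType} (t : T) (u : U) (A : set T) :
  (\forall x \near t, A x) -> \forall z \near (t, u), A z.1.
Proof.
by move=> tA; exists (A, setT) => [|z []//]; split=> //; exact: filterT.
Qed.

Lemma near_snd {T U : topologicalType} (t : T) (u : U) (A : set U) :
  (\forall x \near u, A x) -> \forall z \near (t, u), A z.2.
Proof.
by move=> uA; exists (setT, A) => [|z []//]; split=> //; exact: filterT.
Qed.

(** * Time integrals depending on a parameter: continuity and derivatives *)

Section ParametricIntegral.
Context {R : realType} {n : nat}.
Local Notation mu := (@lebesgue_measure R).
Implicit Types (F P : R -> 'rV[R]_n -> R) (q : 'rV[R]_n) (s t e : R).

Definition jointly_continuous F :=
  continuous (fun z : R * 'rV[R]_n => F z.1 z.2).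

Lemma slice_continuous F q : jointly_continuous F -> continuous (F ^~ q).
Proof.
move=> cF t; apply: (cvg_comp (fun t => (t, q)) _ _ (cF (t, q))).
apply: (@cvg_pair _ _ _ (nbhs t) (nbhs t) (nbhs q)); first exact: cvg_id.
exact: cvg_cst.
Qed.

Lemma jointly_near F t q e : jointly_continuous F -> 0 < e ->
  \forall z \near ((t, q) : R * 'rV[R]_n), `|F z.1 z.2 - F t q| <= e.
Proof. by move=> cF e0; have /cvgrPdistC_le := cF (t, q); exact. Qed.

(** Compactness of [[a, b]] merges the estimates near each [t] into one neighbourhood of [q]. *)
Lemma uniformly_near F a b q e : jointly_continuous F -> 0 < e ->
  \forall q' \near q, forall t, a <= t <= b -> `|F t q' - F t q| <= e.
Proof.
move=> cF e0; have e20 : 0 < e / 2 by lra.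
have /compact_near_coveringP/(_ _ (nbhs q)
  (fun q' t => `|F t q' - F t q| <= e) _) := @segment_compact R a b.
move=> H; apply: filterS (H _) => [q' Kq' t tab|t _].
  by apply: Kq'; rewrite /= in_itv.
have : \forall z \near ((t, q) : R * 'rV[R]_n),
    `|F z.1 q - F t q| <= e / 2.
  apply: (near_fst t q (fun t' => `|F t' q - F t q| <= e / 2)).
  by have /cvgrPdistC_le := slice_continuous _ q cF t; exact.
move=> near1; have near2 := jointly_near _ t q _ cF e20.
apply: filterS2 near1 near2 => -[t' q'] /=.
by rewrite !ler_norml => /andP[? ?] /andP[? ?]; apply/andP; split; lra.
Qed.

Lemma bounded_on_strip F a b N : jointly_continuous F ->
  exists2 M, 0 < M & forall t q, a <= t <= b -> `|q| <= N -> `|F t q| <= M.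
Proof.
move=> cF.
have K : compact (`[a, b] `*` [set q : 'rV[R]_n | `|q - 0| <= N]).
  by apply: compact_setX; [exact: segment_compact|exact: norm_ball_compact].
have /compact_bounded [M [_ hM]] := continuous_compact
  (continuous_subspaceT (A := _ `*` _) cF) K.
exists (`|M| + 1); first by rewrite ltr_wpDl.
move=> t q tab qN; apply: (hM (`|M| + 1)); first by rewrite ltr_pwDr ?ler_norm.
by exists (t, q) => //=; rewrite subr0 in_itv.
Qed.

Lemma intH_sub F s t q : jointly_continuous F -> 0 <= s -> s <= t ->
  intH F t q - intH F s q = \int[mu]_(x in `[s, t]) F x q.
Proof. by move=> cF s0 st; rewrite Rint_chasles//; exact: slice_continuous. Qed.

Lemma intH_sub_bound F s t q c e : jointly_continuous F -> 0 <= s -> s <= t ->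
  (forall x, s <= x <= t -> `|F x q - c| <= e) ->
  `|intH F t q - intH F s q - (t - s) * c| <= e * (t - s).
Proof.
move=> cF s0 st Fe; rewrite intH_sub// mulrC -(Rint_itv_cst s t c)//.
have cFq := slice_continuous _ q cF.
rewrite -RintegralB//; try by apply: continuous_integrable => // x; exact: cvg_cst.
apply: Rint_bound => // x; apply: cvgB; [exact: cFq|exact: cvg_cst].
Qed.

Lemma intH_lipschitz F b N : jointly_continuous F ->
  exists2 M, 0 < M & forall s t q, 0 <= s -> s <= t -> t <= b -> `|q| <= N ->
    `|intH F t q - intH F s q| <= M * (t - s).
Proof.
move=> cF; have [M M0 hM] := bounded_on_strip _ 0 b N cF.
exists M => // s t q s0 st tb qN.
rewrite -[X in `|X|]subr0 -[X in `|_ - X|](mulr0 (t - s)).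
apply: intH_sub_bound => // x /andP[sx xt]; rewrite subr0 hM//.
by rewrite (le_trans s0)// (le_trans xt).
Qed.

Lemma intH_diff_bound F P t q q' e : 0 <= t ->
  jointly_continuous F -> jointly_continuous P ->
  (forall x, 0 <= x <= t -> `|F x q - P x q'| <= e) ->
  `|intH F t q - intH P t q'| <= e * t.
Proof.
move=> t0 cF cP FPe; have cFq := slice_continuous _ q cF.
have cPq := slice_continuous _ q' cP.
rewrite /intH -RintegralB//; try exact: continuous_integrable.
rewrite -[in leRHS](subr0 t); apply: Rint_bound => // x.
by apply: cvgB; [exact: cFq|exact: cPq].
Qed.

(** The increment is taken at [z.2] and not at [q]: it will be applied to maximisers that move with
    the point, so the estimate must be uniform near [q]. *)
Lemma intH_derive_time F t q e : jointly_continuous F -> 0 < t -> 0 < e ->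
  \forall z \near ((t, q) : R * 'rV[R]_n),
    `|intH F z.1 z.2 - intH F t z.2 - (z.1 - t) * F t q| <= e * `|z.1 - t|.
Proof.
move=> cF t0 e0.
have [[U V] /= [/nbhs_ballP[d /= d0 dU] qV] UV] := jointly_near _ t q _ cF e0.
have Ft x q' : `|t - x| < d -> V q' -> `|F x q' - F t q| <= e.
  by move=> tx Vq'; apply: (UV (x, q')); split => //; exact: dU.
exists (`]t - Num.min d t, t + Num.min d t[%classic, V) => /=.
  split=> //; apply: near_in_itvoo; rewrite in_itv/=.
  by rewrite ltrBlDr ltrDl lt_min d0 t0.
move=> -[s q'] /= []; rewrite in_itv/= => /andP[].
rewrite ltrBlDr -ltrBlDl -ltrBlDl !lt_min => /andP[s1 s2] /andP[s3 _] Vq'.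
have [st|ts] := leP s t.
  rewrite [`|s - t|]ler0_norm ?subr_le0// opprB -normrN.
  have -> : - (intH F s q' - intH F t q' - (s - t) * F t q) =
    intH F t q' - intH F s q' - (t - s) * F t q by ring.
  apply: intH_sub_bound => //; first by lra.
  by move=> x /andP[sx xt]; apply: Ft => //; rewrite ger0_norm; lra.
rewrite [`|s - t|]gtr0_norm ?subr_gt0//.
apply: intH_sub_bound => //; [lra|lra|].
by move=> x /andP[sx xt]; apply: Ft => //; rewrite ler0_norm; lra.
Qed.

Lemma intH_continuous F t q e : jointly_continuous F -> 0 < t -> 0 < e ->
  \forall z \near ((t, q) : R * 'rV[R]_n), `|intH F z.1 z.2 - intH F t q| <= e.
Proof.
move=> cF t0 e0.
(* Half of [e] pays for moving [q] over [[0, t]]; the other half pays for the time increment, with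
   slope [F t q] and error rate 1. *)
have e1 : 0 < e / 2 / t by rewrite divr_gt0//; lra.
have e2 : 0 < e / 2 / (`|F t q| + 1) by rewrite divr_gt0 ?ltr_wpDl//; lra.
have near1 := intH_derive_time _ t q _ cF t0 ltr01.
have near2 : \forall z \near ((t, q) : R * 'rV[R]_n),
    forall x, 0 <= x <= t -> `|F x z.2 - F x q| <= e / 2 / t.
  apply: (near_snd t q
    (fun q' => forall x, 0 <= x <= t -> `|F x q' - F x q| <= e / 2 / t)).
  exact: (uniformly_near F 0 t q _ cF e1).
have near3 : \forall z \near ((t, q) : R * 'rV[R]_n),
    `|z.1 - t| <= e / 2 / (`|F t q| + 1).
  apply: (near_fst t q (fun s => `|s - t| <= e / 2 / (`|F t q| + 1))).
  by have /cvgrPdistC_le := @cvg_id _ (nbhs t); exact.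
apply: filterS3 near1 near2 near3 => -[s q'] /= h1 h2 h3.
have := intH_diff_bound _ _ _ _ _ _ (ltW t0) cF cF h2.
rewrite divfK ?gt_eqF// => h4.
have h5 : `|s - t| * (`|F t q| + 1) <= e / 2.
  by rewrite -ler_pdivlMr// ltr_wpDl.
have -> : intH F s q' - intH F t q = (intH F s q' - intH F t q' - (s - t) * F t q)
   + (s - t) * F t q + (intH F t q' - intH F t q) by ring.
apply: (le_trans (ler_normD _ _)); apply: (@le_trans _ _ (e / 2 + e / 2)); last by lra.
apply: lerD => //; apply: (le_trans (ler_normD _ _)).
apply: le_trans h5; rewrite mulrDr mulr1 normrM addrC lerD2l.
by rewrite mul1r in h1.
Qed.

(** Differentiation under the integral sign. By the mean value theorem the difference quotient of
    [F x] is a value of [P x] between [q] and [q + s *: v], close to [P x q] uniformly in [x]. *)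
Lemma intH_rderiv F P t q (v : 'rV[R]_n) :
  jointly_continuous F -> jointly_continuous P -> 0 <= t ->
  (forall x q, 0 <= x <= t ->
     is_derive (0 : R) (1 : R) (fun s : R => F x (q + s *: v)) (P x q)) ->
  rderiv (fun s => intH F t (q + s *: v)) (intH P t q).
Proof.
move=> cF cP t0 FP e e0.
(* The divisor is [t + 1] because [t] may be 0. *)
have t1 : 0 < t + 1 by lra.
have e1 : 0 < e / (t + 1) by rewrite divr_gt0.
have FP' x s : 0 <= x <= t ->
    is_derive s 1 (fun s : R => F x (q + s *: v)) (P x (q + s *: v)).
  move=> xt; apply: is_derive_of_le => c c0.
  have [/derivable_nbhsP/eqaddoP/(_ _ c0) + D] := FP x (q + s *: v) xt.
  rewrite D; apply: filterS => h /=.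
  rewrite -[X in `|X|]/(F x (q + s *: v + (h *: 1 + 0) *: v)
     - (F x (q + s *: v + 0 *: v) + h * P x (q + s *: v))).
  rewrite addr0 scale0r addr0 -[h%:A]/(h * 1) mulr1 -addrA -scalerDl opprD addrA.
  exact.
have := uniformly_near P 0 t q _ cP e1.
move=> /(near0_line _ v) U.
have [d /= d0 dU] : \forall s \near 0^'+, forall s', 0 < s' -> s' < s ->
    forall x, 0 <= x <= t -> `|P x (q + s' *: v) - P x q| <= e / (t + 1).
  move: U => [d /= d0 dU]; exists d => //= s ds s0 s' s'0 s's.
  apply: dU => //; move: ds; rewrite /= !sub0r !normrN !gtr0_norm//.
  exact: lt_trans.
exists d => //= s ds s0; rewrite scale0r addr0.
have main x : 0 <= x <= t ->
   `|F x (q + s *: v) - F x q - s * P x q| <= s * (e / (t + 1)).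
  move=> xt.
  have [||c /[!in_itv]/= /andP[c0 cs]] := @MVT R (fun s => F x (q + s *: v))
    (fun s => P x (q + s *: v)) 0 s s0.
  - by move=> c _; exact: FP'.
  - apply: continuous_subspaceT => c; apply: differentiable_continuous.
    by apply/derivable1_diffP; have [] := FP' x c xt.
  rewrite scale0r addr0 subr0 => ->.
  rewrite mulrC -mulrBr normrM gtr0_norm// ler_pM2l//.
  exact: (dU s).
have cFs (w : 'rV[R]_n) := slice_continuous _ w cF.
have cPs := slice_continuous _ q cP.
rewrite /intH -RintegralB//; try exact: continuous_integrable.
rewrite -RintegralZl//; last exact: continuous_integrable.
rewrite -RintegralB//; last 2 first.
- by apply: continuous_integrable => x; apply: cvgB; exact: cFs.
- by apply: continuous_integrable => x; apply: cvgM; [exact: cvg_cst|exact: cPs].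
apply: (@le_trans _ _ (s * (e / (t + 1)) * (t - 0))).
  apply: Rint_bound => //.
  move=> x; apply: cvgB; first by apply: cvgB; exact: cFs.
  by apply: cvgM; [exact: cvg_cst|exact: cPs].
rewrite subr0 -mulrA mulrC ler_pM2r// mulrAC ler_pdivrMr// ler_pM2l//; lra.
Qed.

End ParametricIntegral.

(** * The Hamiltonian on the strip, its integrated gradient, and condition (A2) *)

Lemma pair_sum_delta {R : realType} {n : nat} (w : R * 'rV[R]_n) :
  w = w.1 *: ((1, 0) : R * 'rV[R]_n) +
      \sum_i w.2 0 i *: ((0, delta_mx 0 i) : R * 'rV[R]_n).
Proof.
have addE (a b : R * 'rV[R]_n) : a + b = (a.1 + b.1, a.2 + b.2) by [].
have scaleE c (a : R * 'rV[R]_n) : c *: a = (c * a.1, c *: a.2) by [].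
have -> : \sum_i w.2 0 i *: ((0, delta_mx 0 i) : R * 'rV[R]_n) = (0, w.2).
  rewrite [in RHS](row_sum_delta w.2).
  elim/big_rec2: _ => [//|i a b _ ->].
  by rewrite addE scaleE /= mulr0 addr0.
by case: w => a b; rewrite addE scaleE /= scaler0 addr0 add0r mulr1.
Qed.

Section Hamiltonian.
Context {R : realType} {n : nat}.
Variables (T : R) (H : R -> 'rV[R]_n -> R).
Hypothesis T0 : 0 < T.
Let strip := [set z : R * 'rV[R]_n | 0 <= z.1 <= T].
Variable D : R * 'rV[R]_n -> {linear (R * 'rV[R]_n)%type -> R^o}.
Hypothesis HD : forall z, strip z -> forall e : R, 0 < e ->
  \forall w \near within strip (nbhs z),
    `|H w.1 w.2 - H z.1 z.2 - D z (w - z)| <= e * `|w - z|.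
Hypothesis cD : forall v, {within strip, continuous (fun z => D z v : R)}.
Implicit Types (q p v : 'rV[R]_n) (s t x : R).

(* [clamp] lets [H], given on [0, T] only, be treated as continuous in all of
   R * 'rV[R]_n; its partial derivatives [Hp] are extended in the same way. *)
Definition clamp x := Num.max 0 (Num.min x T).

Lemma clampE x : 0 <= x <= T -> clamp x = x.
Proof. by move=> /andP[x0 xT]; rewrite /clamp (min_l xT) max_r. Qed.

Lemma clamp_strip x q : strip (clamp x, q).
Proof.
by rewrite /strip /clamp /= le_max lexx /= ge_max (ltW T0) ge_min lexx orbT.
Qed.

Definition Hc x q := H (clamp x) q.
Definition Hp v x q : R := D (clamp x, q) (0, v).

Lemma clamp_continuous : continuous clamp.
Proof.
move=> x; apply: (@continuous_max R R (cst 0) (fun x => Num.min x T)).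
  exact: cvg_cst.
by apply: (@continuous_min R R id (cst T)); [exact: cvg_id|exact: cvg_cst].
Qed.

Lemma clamp_fst_continuous :
  continuous (fun z : R * 'rV[R]_n => (clamp z.1, z.2)).
Proof.
move=> z; apply: (@cvg_pair _ _ _ (nbhs z) (nbhs (clamp z.1)) (nbhs z.2)).
  apply: (cvg_comp fst clamp _ (clamp_continuous z.1)).
  exact: (@cvg_fst _ _ (nbhs z.1) (nbhs z.2)).
exact: (@cvg_snd _ _ (nbhs z.1) (nbhs z.2)).
Qed.

Lemma Hp_continuous v : jointly_continuous (Hp v).
Proof.
exact: (@continuous_comp_within (R * 'rV[R]_n)%type (R * 'rV[R]_n)%type R
  strip (fun z => D z (0, v) : R) (fun z => (clamp z.1, z.2))
  (cD (0, v)) clamp_fst_continuous (fun z => clamp_strip z.1 z.2)).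
Qed.

Lemma linear_line z s v : D z (s *: ((0, v) : R * 'rV[R]_n)) = s * D z (0, v).
Proof. by rewrite linearZ. Qed.

Lemma HpE v x q : Hp v x q = \sum_i v 0 i * Hp (delta_mx 0 i) x q.
Proof.
rewrite /Hp (pair_sum_delta (0, v)) linearD linear_sum linearZ /= scale0r add0r.
by apply: eq_bigr => i _; rewrite linearZ.
Qed.

Lemma Hc_continuous : jointly_continuous Hc.
Proof.
suff : {within strip, continuous (fun z => H z.1 z.2)}.
  move=> cH; exact: (@continuous_comp_within (R * 'rV[R]_n)%type (R * 'rV[R]_n)%type R
    strip _ (fun z => (clamp z.1, z.2)) cH clamp_fst_continuous
    (fun z => clamp_strip z.1 z.2)).
apply/subspace_continuousP => z zs; apply/cvgrPdistC_le => e e0.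
(* [K - 1] bounds the linear form [D z] through its values on the standard basis; the extra 1
   absorbs the error of the differential. *)
set K := `|D z (1, 0)| + \sum_i `|D z (0, delta_mx 0 i)| + 1.
have K0 : 0 < K by rewrite ltr_wpDl// addr_ge0// sumr_ge0.
have Dle w : `|D z w| <= (K - 1) * `|w|.
  rewrite [in D z w](pair_sum_delta w) linearD linear_sum linearZ /=.
  rewrite addrK mulrDl; apply: (le_trans (ler_normD _ _)); apply: lerD.
    by rewrite normrM mulrC ler_wpM2l// prod_normE le_max lexx.
  rewrite mulr_suml; apply: (le_trans (ler_norm_sum _ _ _)); apply: ler_sum => i _.
  rewrite linearZ normrM mulrC ler_wpM2l// (le_trans (coord_le_norm _ _))//.
  by rewrite prod_normE le_max lexx orbT.
have eK : 0 < e / K by rewrite divr_gt0.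
near=> w.
have wz : `|w - z| <= e / K.
  near: w; apply: cvg_within.
  by have /cvgrPdistC_le := @cvg_id _ (nbhs z); exact.
have Hw : `|H w.1 w.2 - H z.1 z.2 - D z (w - z)| <= 1 * `|w - z|.
  by near: w; exact: HD.
rewrite -[X in `|X|](subrK (D z (w - z))).
apply: (le_trans (ler_normD _ _)).
apply: (le_trans (lerD Hw (Dle _))).
by rewrite -mulrDl addrC subrK mulrC -ler_pdivlMr.
Unshelve. all: by end_near. Qed.

Lemma Hc_line x q v e : 0 < e ->
  \forall h \near (0 : R), `|Hc x (q + h *: v) - Hc x q - h * Hp v x q| <= e * `|h|.
Proof.
move=> e0; have [e1 ev] := divr_mulr_le e _ e0 (normr_ge0 v).
have := HD _ (clamp_strip x q) _ e1.
rewrite near_withinE => /(near_line _ (0, v)); apply: filterS => h.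
have -> : ((clamp x, q) : R * 'rV[R]_n) + h *: (0, v) = (clamp x, q + h *: v).
  by congr (_, _); rewrite /= scaler0 addr0.
(* Only the second variable moves, so the line never leaves the strip. *)
move=> /(_ (clamp_strip _ _)) /=.
have -> : ((clamp x, q + h *: v) : R * 'rV[R]_n) - (clamp x, q) = h *: (0, v).
  by congr (_, _); rewrite /= ?subrr ?scaler0// addrAC subrr add0r.
rewrite linear_line => /le_trans; apply.
by rewrite normrZ prod_normE normr0 max_r// mulrCA mulrC ler_wpM2r.
Qed.

Lemma Hc_rderiv x q v : rderiv (fun s => Hc x (q + s *: v)) (Hp v x q).
Proof.
move=> e e0; near=> s.
have s0 : 0 < s by [].
have : `|Hc x (q + s *: v) - Hc x q - s * Hp v x q| <= e * `|s|.
  by near: s; apply: cvg_within; exact: Hc_line.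
by rewrite scale0r addr0 (gtr0_norm s0).
Unshelve. all: by end_near. Qed.

Lemma Hc_derive x q v :
  is_derive (0 : R) (1 : R) (fun s : R => Hc x (q + s *: v)) (Hp v x q).
Proof.
apply: is_derive_of_le => e e0; apply: filterS (Hc_line x q v e e0) => h.
by rewrite add0r scale0r addr0.
Qed.

Lemma intH_clamp t q : 0 <= t <= T -> intH H t q = intH Hc t q.
Proof.
move=> /andP[t0 tT]; apply: eq_Rintegral => x; rewrite inE/= in_itv/= => /andP[x0 xt].
by rewrite /Hc clampE// x0 (le_trans xt).
Qed.

(** The gradient in [q] of [intH H t]. Between times [s] and [t], a characteristic with momentum [p]
    is displaced by [gradH t p - gradH s p]. *)
Definition gradH t q : 'rV[R]_n := \row_i intH (Hp (delta_mx 0 i)) t q.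

Lemma intH_Hp v t q : intH (Hp v) t q = dot v (gradH t q).
Proof.
rewrite /dot /intH; under eq_Rintegral do rewrite HpE.
rewrite Rint_sum; last first.
  move=> i x; apply: cvgM; first exact: cvg_cst.
  exact: (slice_continuous _ q (Hp_continuous _)).
apply: eq_bigr => i _; rewrite mxE RintegralZl//.
by apply: continuous_integrable; exact: (slice_continuous _ q (Hp_continuous _)).
Qed.

Lemma intH_gradH t q v : 0 <= t <= T ->
  rderiv (fun s => intH H t (q + s *: v)) (dot v (gradH t q)).
Proof.
move=> tT; rewrite -intH_Hp.
rewrite (_ : (fun s => _) = (fun s => intH Hc t (q + s *: v))); last first.
  by apply/funext => s; rewrite intH_clamp.
apply: intH_rderiv; [exact: Hc_continuous|exact: Hp_continuous| |].
  by case/andP: tT.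
by move=> x q' _; exact: Hc_derive.
Qed.

(** Makes the displacement of characteristics over a short time small, uniformly over bounded
    momenta. *)
Lemma gradH_lipschitz N : exists2 M, 0 < M & forall s t q,
  0 <= s -> s <= t -> t <= T -> `|q| <= N ->
  `|gradH t q - gradH s q| <= M * (t - s).
Proof.
have hM i : exists M, 0 < M /\ forall s t q, 0 <= s -> s <= t -> t <= T ->
    `|q| <= N -> `|gradH t q 0 i - gradH s q 0 i| <= M * (t - s).
  have [M M0 hM] := intH_lipschitz _ T N (Hp_continuous (delta_mx 0 i)).
  by exists M; split => // s t q s0 st tT qN; rewrite !mxE hM.
have [M {}hM] := choice hM.
have M0 : 0 <= \sum_i M i by apply: sumr_ge0 => i _; rewrite ltW// (hM i).1.
exists (1 + \sum_i M i); first by rewrite ltr_pwDl.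
move=> s t q s0 st tT qN; apply: norm_le_coords => [|i].
  by rewrite mulr_ge0 ?subr_ge0// addr_ge0.
rewrite !mxE; have := (hM i).2 _ _ _ s0 st tT qN; rewrite !mxE => /le_trans; apply.
rewrite ler_wpM2r ?subr_ge0// (bigD1 i)//= addrCA lerDl.
by rewrite addr_ge0// sumr_ge0// => j _; rewrite ltW// (hM j).1.
Qed.

Lemma intH_lipschitz_strip N : exists2 M, 0 < M & forall s t q,
  0 <= s -> s <= t -> t <= T -> `|q| <= N ->
  `|intH H t q - intH H s q| <= M * (t - s).
Proof.
have [M M0 hM] := intH_lipschitz _ T N Hc_continuous.
exists M => // s t q s0 st tT qN.
have sT : 0 <= s <= T by rewrite s0 (le_trans st).
have tT' : 0 <= t <= T by rewrite (le_trans s0 st).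
by rewrite !intH_clamp// hM.
Qed.

Lemma near_strip t q : 0 < t < T ->
  \forall z \near ((t, q) : R * 'rV[R]_n), 0 < z.1 < T.
Proof.
move=> tT; apply: (near_fst t q (fun s => 0 < s < T)).
have := @near_in_itvoo R 0 T t; rewrite in_itv/= => /(_ tT).
by apply: filterS => s; rewrite in_itv.
Qed.

Lemma intH_strip_continuous t q e : 0 < t < T -> 0 < e ->
  \forall z \near ((t, q) : R * 'rV[R]_n), `|intH H z.1 z.2 - intH H t q| <= e.
Proof.
move=> tT e0; have /andP[t0 ltT] := tT.
apply: filterS2 (near_strip t q tT) (intH_continuous _ t q _ Hc_continuous t0 e0).
move=> z /andP[z0 zT]; have zT' : 0 <= z.1 <= T by rewrite !ltW.
have tT' : 0 <= t <= T by rewrite !ltW.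
by rewrite !intH_clamp.
Qed.

Lemma intH_strip_derive t q e : 0 < t < T -> 0 < e ->
  \forall z \near ((t, q) : R * 'rV[R]_n),
    `|intH H z.1 z.2 - intH H t z.2 - (z.1 - t) * H t q| <= e * `|z.1 - t|.
Proof.
move=> tT e0; have /andP[t0 ltT] := tT.
apply: filterS2 (near_strip t q tT) (intH_derive_time _ t q _ Hc_continuous t0 e0).
move=> z /andP[z0 zT]; have zT' : 0 <= z.1 <= T by rewrite !ltW.
have tT' : 0 <= t <= T by rewrite !ltW.
by rewrite !intH_clamp// /Hc clampE.
Qed.

(* The integral over [0, t] of the gap between [H tau] and its tangent at [p],
   the only quantity on which the sign condition (A2) bears. *)
Definition excess t p q := intH H t q - intH H t p - dot (q - p) (gradH t p).

Lemma excess0 p q : excess 0 p q = 0.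
Proof.
have int0 (f : R -> 'rV[R]_n -> R) w : intH f 0 w = 0.
  by rewrite /intH set_itv1 Rintegral_set1.
have grad0 : gradH 0 p = 0 by apply/rowP => i; rewrite !mxE int0.
by rewrite /excess !int0 grad0 dotC dot0l !subr0.
Qed.

(** The half-open interval leaves out time 0: for [t < T] it lies in [(0, T)], where (A2)
    applies. *)
Lemma excess_sub s t p q : 0 <= s -> s <= t -> t <= T ->
  excess t p q - excess s p q = \int[lebesgue_measure]_(x in `]s, t])
    (Hc x q - Hc x p - Hp (q - p) x p).
Proof.
move=> s0 st tT.
have cH w := slice_continuous _ w Hc_continuous.
have cP := slice_continuous _ p (Hp_continuous (q - p)).
have cE : continuous (fun x => Hc x q - Hc x p - Hp (q - p) x p).
  move=> x; apply: cvgB; last exact: cP.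
  by apply: cvgB; exact: cH.
rewrite Rintegral_itv_obnd_cbnd; last first.
  apply: integrableS (continuous_integrable _ s t cE) => //.
  by apply: subset_itvr; rewrite bnd_simp.
rewrite RintegralB//; last 2 first.
- by apply: continuous_integrable => x; apply: cvgB; exact: cH.
- exact: continuous_integrable.
rewrite RintegralB//; try exact: continuous_integrable.
rewrite -!(intH_sub _ s t)//; try exact: Hc_continuous; try exact: Hp_continuous.
have sT : 0 <= s <= T by rewrite s0 (le_trans st).
have tT' : 0 <= t <= T by rewrite (le_trans s0 st).
by rewrite !intH_Hp /excess !intH_clamp//; ring.
Qed.

(** For fixed [p] and [q] the integrand has one sign on [(0, T)]: a convex function lies above its
    tangents, a concave one below, and in the product form the integrand is [g] times a constant. In
    this last form the alternative that holds may vary with [p] and [q]. *)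
Lemma excess_monotone p q : condA2 T H ->
  (forall s t, 0 <= s -> s <= t -> t < T -> excess s p q <= excess t p q) \/
  (forall s t, 0 <= s -> s <= t -> t < T -> excess t p q <= excess s p q).
Proof.
move=> A2.
suff sgn : (forall x, 0 < x < T -> 0 <= Hc x q - Hc x p - Hp (q - p) x p) \/
    (forall x, 0 < x < T -> 0 <= - (Hc x q - Hc x p - Hp (q - p) x p)).
  have inT s t x : 0 <= s -> t < T -> x \in `]s, t]%R -> 0 < x < T.
    rewrite in_itv/= => s0 tT /andP[sx xt].
    by rewrite (le_lt_trans s0 sx) (le_lt_trans xt).
  case: sgn => sgn; [left|right] => s t s0 st tT.
    rewrite -subr_ge0 excess_sub// ?(ltW tT)//; apply: Rintegral_ge0 => x xst.
    by apply: sgn; exact: inT xst.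
  rewrite -subr_le0 excess_sub// ?(ltW tT)// -oppr_ge0 -mulN1r -RintegralZl//.
    apply: Rintegral_ge0 => x xst; rewrite mulN1r.
    by apply: sgn; exact: inT xst.
  have cE : continuous (fun x => Hc x q - Hc x p - Hp (q - p) x p).
    move=> x; apply: cvgB; last exact: (slice_continuous _ p (Hp_continuous (q - p))).
    by apply: cvgB; exact: (slice_continuous _ _ Hc_continuous).
  apply: integrableS (continuous_integrable _ s t cE) => //.
  by apply: subset_itvr; rewrite bnd_simp.
have HcE x w : 0 < x < T -> Hc x w = H x w.
  by move=> /andP[x0 xT]; rewrite /Hc clampE// !ltW.
have Hd x : 0 < x < T -> rderiv (fun s => H x (p + s *: (q - p))) (Hp (q - p) x p).
  move=> xT; have := Hc_rderiv x p (q - p).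
  by under eq_fun do rewrite HcE//.
have cvx (f : 'rV[R]_n -> R) d : convex_function [set: 'rV[R]_n] f ->
    rderiv (fun s => f (p + s *: (q - p))) d -> 0 <= f q - f p - d.
  move=> cf df; rewrite subr_ge0; apply: rderiv_le df _; near=> s.
  rewrite scale0r addr0.
  have s01 : 0 <= s <= 1 by rewrite ltW//=; near: s; exact: nbhs_right_le.
  by have := convexP _ cf p q s s01; lra.
case: A2 => [Hcvx|Hccv|[g [h [k [HE gsgn]]]]].
- left => x xT; rewrite !HcE//; apply: cvx (Hcvx _ xT) (Hd _ xT).
- right => x xT; rewrite !HcE//.
  by have := cvx _ _ (Hccv _ xT) (rderivN _ _ (Hd _ xT)); lra.
(* [h] is not assumed differentiable. A time [y] with [g y != 0] recovers its directional derivative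
   from that of [H y]; if [g] vanishes on [(0, T)], so does [Hp (q - p) x p], and [d = 0] will
   do. *)
have [d hd] : exists d, forall x, 0 < x < T -> Hp (q - p) x p = g x * d.
  have Hd' x : 0 < x < T ->
      rderiv (fun s => g x * h (p + s *: (q - p)) + k x) (Hp (q - p) x p).
    by move=> xT; have := Hd x xT; under eq_fun do rewrite HE//.
  have [[y yT gy]|g0] := pselect (exists2 y, 0 < y < T & g y != 0).
    exists ((g y)^-1 * Hp (q - p) y p) => x xT.
    apply: rderiv_uniq (Hd' x xT) _.
    rewrite -[X in rderiv _ X]addr0; apply: rderivD; last exact: rderivC.
    apply: rderivZ.
    have := rderivZ _ (g y)^-1 _ (rderivD _ _ _ _ (Hd' y yT) (rderivC (- k y))).
    rewrite addr0; congr (rderiv _ _); apply/funext => s.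
    by rewrite addrK mulKf.
  exists 0 => x xT; have gx : g x = 0.
    by apply/eqP/negPn/negP => gx; apply: g0; exists x.
  apply: rderiv_uniq (Hd' x xT) _; rewrite mulr0.
  under eq_fun do rewrite gx mul0r add0r.
  exact: rderivC.
have E x : 0 < x < T -> Hc x q - Hc x p - Hp (q - p) x p = g x * (h q - h p - d).
  by move=> xT; rewrite !HcE// !HE// hd//; ring.
have [e0|e0] := leP 0 (h q - h p - d); case: gsgn => gs.
- by left => x xT; rewrite E// mulr_ge0// gs.
- by right => x xT; rewrite E// -mulNr mulr_ge0// oppr_ge0 gs.
- by right => x xT; rewrite E// -mulrN mulr_ge0 ?gs// oppr_ge0 ltW.
- by left => x xT; rewrite E// mulr_le0 ?gs// ltW.
Unshelve. all: by end_near. Qed.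

End Hamiltonian.

(** * Joint differentiability and subgradients in space *)

Lemma differentiable_of_le {R : realType} {V : normedModType R} (f : V -> R)
    (L : {linear V -> R}) (x : V) : continuous L ->
  (forall e, 0 < e -> \forall z \near x, `|f z - f x - L (z - x)| <= e * `|z - x|) ->
  differentiable f x.
Proof.
move=> cL fL.
have fE : f \o shift x = cst (f x) + L +o_ 0 id.
  apply/eqaddoP => e e0; rewrite near_simpl.
  have := fL e e0; rewrite (near_shift 0 x) /= => H.
  apply: filterS H => h /=.
  by rewrite subr0 addrK opprD addrA.
have dE := diff_unique cL fE.
by apply/diff_locallyP; rewrite dE; split.
Qed.

(** Difference quotients in the directions [v] and [- v] bound [dot v p] from both sides. The
    inequality is asked near [x] only, which is what [characteristic_point] provides. *)
Lemma diff_subgrad {R : realType} {n : nat} (u : R -> 'rV[R]_n -> R) t x p :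
  differentiable (fun z : R * 'rV[R]_n => u z.1 z.2) (t, x) ->
  (\forall y \near x, u t x + dot (y - x) p <= u t y) ->
  forall v, dot v p = 'd (fun z : R * 'rV[R]_n => u z.1 z.2) (t, x) (0, v).
Proof.
set f := fun z => _; move=> df sub.
have le v : dot v p <= 'd f (t, x) (0, v).
  have rd : rderiv (fun s => u t (x + s *: v)) ('d f (t, x) (0, v)).
    move=> e e0; have [e1 ev] := divr_mulr_le e _ e0 (normr_ge0 v).
    have /eqaddoP/(_ _ e1) := diff_locally df.
    rewrite near_simpl => /(near0_line _ (0, v)); apply: filter_app; near=> s.
    have s0 : 0 < s by [].
    rewrite add0r.
    have -> : s *: ((0, v) : R * 'rV[R]_n) = (0, s *: v).
      by congr (_, _); rewrite /= scaler0.
    rewrite -[X in `|X|]/(u (0 + t) (s *: v + x) - (u t x + 'd f (t, x) (0, s *: v))).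
    have -> : ((0, s *: v) : R * 'rV[R]_n) = s *: (0, v).
      by congr (_, _); rewrite /= scaler0.
    rewrite linearZ add0r [s *: v + x]addrC opprD addrA scale0r addr0.
    move=> /le_trans; apply.
    rewrite normrZ prod_normE normr0 max_r// (gtr0_norm s0) mulrCA mulrC.
    by rewrite ler_wpM2r// ltW.
  apply: rderiv_ge rd _; have := near0_line _ v _ sub.
  apply: filterS => s; rewrite [x + _ - x]addrAC subrr add0r dotZl scale0r addr0.
  by lra.
move=> v; apply/eqP; rewrite eq_le le /=.
have := le (- v); rewrite dotNl.
have -> : ((0, - v) : R * 'rV[R]_n) = - (0, v) by congr (_, _); rewrite /= oppr0.
by rewrite linearN lerN2.
Unshelve. all: by end_near. Qed.

(** * The functional to be minimised: continuity, and conjugates over a bounded set *)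

Lemma tilted_continuous {R : realType} {n : nat} (f g h : 'rV[R]_n -> R)
    (x : 'rV[R]_n) : continuous f -> continuous g -> continuous h ->
  continuous (fun q => f q - (g q - h q) - dot x q).
Proof.
move=> cf cg ch q; have Fq : Filter (nbhs q) := nbhs_filter q.
apply: cvgB; last first.
  exact: (@cvg_dot _ _ _ (nbhs q) Fq (fun=> x) id x q (@cvg_cst _ _ _ _ Fq) cvg_id).
apply: cvgB; first exact: cf.
by apply: cvgB; [exact: cg|exact: ch].
Qed.

(* The Fenchel conjugate of [f + \chi_B]. *)
Definition conj_on {R : realType} {n : nat} (B : set 'rV[R]_n)
    (f : 'rV[R]_n -> R) (q : 'rV[R]_n) : R :=
  sup [set dot y q - f y | y in B].

Section ConjOn.
Context {R : realType} {n : nat}.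
Variables (B : set 'rV[R]_n) (f : 'rV[R]_n -> R) (X C : R).
Hypothesis B0 : B !=set0.
Hypothesis BX : forall y, B y -> `|y| <= X.
Hypothesis fC : forall y, B y -> `|f y| <= C.
Implicit Types (y q : 'rV[R]_n) (c : R).

Lemma dot_on_le y q : B y -> `|dot y q| <= n%:R * X * `|q|.
Proof.
move=> yB; apply: (le_trans (dot_le _ _)).
by rewrite ler_wpM2r// ler_wpM2l// BX.
Qed.

Lemma conj_on_ge y q : B y -> dot y q - f y <= conj_on B f q.
Proof.
move=> yB; apply: ub_le_sup; last by exists y.
exists (n%:R * X * `|q| + C) => _ [z zB <-].
have := dot_on_le z q zB; have := fC z zB; rewrite !ler_norml.
by move=> /andP[? ?] /andP[? ?]; lra.
Qed.

Lemma conj_on_le q c :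
  (forall y, B y -> dot y q - f y <= c) -> conj_on B f q <= c.
Proof.
move=> qc; apply: ge_sup; last by move=> _ [y yB <-]; exact: qc.
by have [y yB] := B0; exists (dot y q - f y); exists y.
Qed.

Lemma conj_on_lipschitz q q' :
  conj_on B f q' <= conj_on B f q + n%:R * X * `|q' - q|.
Proof.
apply: conj_on_le => y yB; have := conj_on_ge y q yB.
have := dot_on_le y (q' - q) yB; rewrite ler_norml => /andP[_].
by rewrite !dotE; lra.
Qed.

Lemma conj_on_continuous : continuous (conj_on B f).
Proof.
have X0 : 0 <= X by have [y /BX] := B0; exact: le_trans.
have K0 : 0 < n%:R * X + 1 by rewrite ltr_wpDl// mulr_ge0.
move=> q; apply/(@cvgrPdistC_le _ _ _ (nbhs q)) => e e0.
have e1 : 0 < e / (n%:R * X + 1) by rewrite divr_gt0.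
apply: filterS (near_dist q _ e1) => q'.
rewrite ltr_pdivlMr// mulrDr mulr1 mulrC => qq; have := normr_ge0 (q' - q) => qq0.
have := conj_on_lipschitz q q'; have := conj_on_lipschitz q' q; rewrite (distrC q q').
by move=> ? ?; rewrite ler_norml; apply/andP; split; lra.
Qed.

End ConjOn.

(** * Regularity of the Hopf formula and propagation of its singularities *)

Section Hopf.
Context {R : realType} {n : nat}.
Variables (T : R) (H : R -> 'rV[R]_n -> R) (sigma : 'rV[R]_n -> R).
Hypothesis T0 : 0 < T.
Variable D : R * 'rV[R]_n -> {linear (R * 'rV[R]_n)%type -> R^o}.
Hypothesis HD : forall z, 0 <= z.1 <= T -> forall e : R, 0 < e ->
  \forall w \near within [set z : R * 'rV[R]_n | 0 <= z.1 <= T] (nbhs z),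
    `|H w.1 w.2 - H z.1 z.2 - D z (w - z)| <= e * `|w - z|.
Hypothesis cD : forall v, {within [set z : R * 'rV[R]_n | 0 <= z.1 <= T],
  continuous (fun z => D z v : R)}.
Hypothesis sigma_convex : convex_function [set: 'rV[R]_n] sigma.
Hypothesis sigma_C1 : C1_on [set: 'rV[R]_n] sigma.
Hypothesis A1 : condA1 T sigma H.
Hypothesis A2 : condA2 T H.
Implicit Types (q p v x y : 'rV[R]_n) (s t : R).

Local Notation u := (hopf sigma H).
Local Notation ismax := (is_max sigma H).
Local Notation grad := (gradH T D).

Lemma intH_cvg t q : 0 < t < T ->
  (fun z : R * 'rV[R]_n => intH H z.1 z.2) @ (t, q) --> intH H t q.
Proof.
move=> tT; apply/cvgrPdistC_le => e e0.
exact: (intH_strip_continuous T H T0 D HD).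
Qed.

Lemma is_max_exists t x : 0 <= t < T -> exists p, ismax t x p.
Proof.
move=> tT; have [r r0 [N _ hN]] := condA1_is_max _ _ _ t x A1 tT.
apply: (hN t x tT _).1.
by rewrite !subrr normr0 add0r enorm0.
Qed.

(** A maximiser at [x] still competes at [y]. *)
Lemma is_max_subgrad t x y p : 0 <= t < T -> ismax t x p ->
  u t x + dot (y - x) p <= u t y.
Proof.
move=> tT /[dup] xp [a pa _]; have [q yq] := is_max_exists t y tT.
rewrite (hopf_is_max _ _ _ _ _ _ xp pa).
by have := hopf_ge _ _ _ _ _ _ _ yq pa; rewrite !dotE; lra.
Qed.

(* Backward along the characteristic through [(ts, x)] with momentum [p], the
   gap [b - a - <y, q - p> + excess t p q] between the values of [p] and [q]
   lies between its values at times 0 and [ts], both positive for [q != p]. *)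
Lemma is_max_backward t ts x p : 0 <= t -> t <= ts -> ts < T ->
  ismax ts x p -> (forall q, ismax ts x q -> q = p) ->
  ismax t (x - grad ts p + grad t p) p /\
  forall q, ismax t (x - grad ts p + grad t p) q -> q = p.
Proof.
move=> t0 tts tsT [a pa pmax] puniq; set y := x - grad ts p.
have tsT' : 0 <= ts <= T by rewrite (le_trans t0 tts) ltW.
(* The first-order condition for [p] at time [ts], along the segment to [q], makes [y] a subgradient
   of [sigma^*] at [p]. *)
have ysub q b : fenchel sigma q = b%:E -> a + dot y (q - p) <= b.
  move=> qb; have rd := intH_gradH T H T0 D HD cD ts p (q - p) tsT'.
  suff : dot x (q - p) - (b - a) <= dot (q - p) (grad ts p).
    by rewrite /y [dot (x - _) _]dotDl dotNl (dotC (grad ts p)); lra.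
  apply: rderiv_ge rd _; near=> s.
  have s01 : 0 <= s <= 1 by rewrite ltW//=; near: s; exact: nbhs_right_le.
  have [c fc cle] := fenchel_convex sigma p q a b s s01 pa qb.
  have := pmax _ _ fc; rewrite scale0r addr0 dotDr dotZr; lra.
have [G dG] := C1_on_gradient _ sigma_C1 y.
have pG : p = G by apply: fenchel_subgrad_uniq sigma_convex dG pa ysub.
have uniq q b : fenchel sigma q = b%:E ->
    b - a - dot y (q - p) + excess T H D t p q <= 0 -> q = p.
  move=> qb gap.
  (* [excess] is monotone in time, so a gap that is nonpositive at [t] is so at time 0 or at time
     [ts]. *)
  have : b - a - dot y (q - p) <= 0 \/
         b - a - dot y (q - p) + excess T H D ts p q <= 0.
    have [up|down] := excess_monotone T H T0 D HD cD p q A2.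
      left; have := up 0 t (lexx _) t0 (le_lt_trans tts tsT).
      by rewrite excess0; lra.
    by right; have := down t ts t0 tts tsT; lra.
  (* In the first case [y] is a subgradient of [sigma^*] at [q] as well, so [q] is the gradient of
     [sigma] at [y]; in the second [q] is a maximiser at [(ts, x)]. *)
  case=> [b0|bts].
    rewrite pG; apply: fenchel_subgrad_uniq sigma_convex dG qb _ => q' b' qb'.
    by have := ysub _ _ qb'; rewrite !dotE in b0 *; lra.
  apply: puniq; exists b => // q' b' qb'; apply: le_trans (pmax _ _ qb') _.
  by move: bts; rewrite /excess /y !dotE !(dotC _ (grad _ _)); lra.
have gapE q b : (dot (y + grad t p) q - b - intH H t q <=
    dot (y + grad t p) p - a - intH H t p) =
    (0 <= b - a - dot y (q - p) + excess T H D t p q).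
  rewrite -[LHS]subr_ge0; congr (0 <= _).
  by rewrite /excess !dotE !(dotC _ (grad t p)); ring.
have gapE' q b : (dot (y + grad t p) p - a - intH H t p <=
    dot (y + grad t p) q - b - intH H t q) =
    (b - a - dot y (q - p) + excess T H D t p q <= 0).
  rewrite -[LHS]subr_le0; congr (_ <= 0).
  by rewrite /excess !dotE !(dotC _ (grad t p)); ring.
split.
  exists a => // q b qb; rewrite gapE leNgt; apply/negP => gap.
  have qp := uniq _ _ qb (ltW gap); move: gap.
  have ab : a = b by apply: EFin_inj; rewrite -pa -qb qp.
  by rewrite qp ab /excess !subrr (dotC y) !dot0l !subr0 addr0 ltxx.
move=> q [b qb qmax]; apply: uniq qb _; rewrite -gapE'; exact: qmax.
Unshelve. all: by end_near. Qed.


(** Upper semicontinuity of the set of maximisers where it is a singleton. By (A1) maximisers at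
    nearby points stay in a fixed compact ball, and each [q != p] of this ball has a neighbourhood
    that contains none of them. *)
Lemma is_max_near t x p eta : 0 < t < T -> ismax t x p ->
  (forall q, ismax t x q -> q = p) -> 0 < eta ->
  \forall z \near ((t, x) : R * 'rV[R]_n),
    forall q, ismax z.1 z.2 q -> `|q - p| <= eta.
Proof.
move=> tT [a pa pmax] puniq eta0.
have tT' : 0 <= t < T by case/andP: tT => t0 ->; rewrite ltW.
have [r r0 [N N0 hN]] := condA1_is_max _ _ _ t x A1 tT'.
have /compact_near_coveringP/(_ _ (nbhs ((t, x) : R * 'rV[R]_n))
  (fun z q => ismax z.1 z.2 q -> `|q - p| <= eta) _) cover :=
  norm_ball_compact (0 : 'rV[R]_n) N.
have bounded : \forall z \near ((t, x) : R * 'rV[R]_n),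
    0 <= z.1 < T /\ `|z.1 - t| + enorm (z.2 - x) < r.
  have d0 : 0 < r / 2 / (n%:R + 1) by rewrite !divr_gt0// ltr_wpDl.
  have nb1 : \forall z \near ((t, x) : R * 'rV[R]_n), `|z.1 - t| < r / 2.
    apply: (near_fst t x (fun s => `|s - t| < r / 2)).
    by apply: near_dist; lra.
  have nb2 : \forall z \near ((t, x) : R * 'rV[R]_n), `|z.2 - x| < r / 2 / (n%:R + 1).
    apply: (near_snd t x (fun y => `|y - x| < r / 2 / (n%:R + 1))).
    exact: near_dist.
  apply: filterS3 (near_strip T t x tT) nb1 nb2 => z /andP[z0 zT] zt zx.
  split; first by rewrite ltW.
  have : `|z.2 - x| * (n%:R + 1) < r / 2 by rewrite -ltr_pdivlMr// ltr_wpDl.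
  rewrite mulrDr mulr1 mulrC => zx'.
  by have := enorm_le (z.2 - x); have := normr_ge0 (z.2 - x); lra.
apply: filterS2 bounded (cover _) => [z [zT zx] cov q zq|q qN].
  apply: (cov q) => //=; rewrite subr0.
  exact: le_trans (norm_le_enorm q) ((hN _ _ zT zx).2 q zq).
have [->|qp] := eqVneq q p.
  have : \forall w \near ((p, (t, x)) : 'rV[R]_n * (R * 'rV[R]_n)), `|w.1 - p| <= eta.
    apply: (near_fst p ((t, x) : R * 'rV[R]_n) (fun w => `|w - p| <= eta)).
    by apply: filterS (near_dist p _ eta0) => y /ltW.
  exact: filterS.
(* [sigma^*] need not be continuous, so it is replaced by one affine minorant [dot y q - sigma y]
   whose value at [q] already excludes [q]; the resulting [gap] is continuous at [(q, (t, x))]. *)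
have [y yq] : exists y, dot x q - intH H t q - (dot x p - a - intH H t p) <
    dot y q - sigma y.
  apply: contrapT => /forallNP noy.
  have : (fenchel sigma q <=
      (dot x q - intH H t q - (dot x p - a - intH H t p))%:E)%E.
    by apply/fenchel_leP => y; rewrite leNgt; apply/negP/noy.
  have [->//|[b qb]] := fenchel_case sigma q; rewrite qb lee_fin => ble.
  move/eqP: qp; apply; apply: puniq; exists b => // q' b' qb'.
  by apply: le_trans (pmax _ _ qb') _; lra.
pose gap (w : 'rV[R]_n * (R * 'rV[R]_n)) :=
  dot w.2.2 (w.1 - p) - dot y w.1 - intH H w.2.1 w.1 + intH H w.2.1 p.
have cfst : fst w @[w --> ((q, (t, x)) : 'rV[R]_n * (R * 'rV[R]_n))] --> q.
  exact: (@cvg_fst _ _ (nbhs q) (nbhs ((t, x) : R * 'rV[R]_n))).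
have csnd : snd w @[w --> ((q, (t, x)) : 'rV[R]_n * (R * 'rV[R]_n))] -->
    ((t, x) : R * 'rV[R]_n).
  exact: (@cvg_snd _ _ (nbhs q) (nbhs ((t, x) : R * 'rV[R]_n))).
have ct : w.2.1 @[w --> ((q, (t, x)) : 'rV[R]_n * (R * 'rV[R]_n))] --> t.
  exact: (cvg_comp snd fst csnd (@cvg_fst _ _ (nbhs t) (nbhs x) _)).
have cx : w.2.2 @[w --> ((q, (t, x)) : 'rV[R]_n * (R * 'rV[R]_n))] --> x.
  exact: (cvg_comp snd snd csnd (@cvg_snd _ _ (nbhs t) (nbhs x) _)).
have cgap : gap w @[w --> ((q, (t, x)) : 'rV[R]_n * (R * 'rV[R]_n))] -->
    dot x (q - p) - dot y q - intH H t q + intH H t p.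
  have cJ (g : 'rV[R]_n * (R * 'rV[R]_n) -> 'rV[R]_n) l :
      g w @[w --> ((q, (t, x)) : 'rV[R]_n * (R * 'rV[R]_n))] --> l ->
      intH H w.2.1 (g w) @[w --> ((q, (t, x)) : 'rV[R]_n * (R * 'rV[R]_n))]
        --> intH H t l.
    move=> gl; apply: (cvg_comp (fun w => (w.2.1, g w)) (fun z => intH H z.1 z.2)
      _ (intH_cvg t l tT)).
    exact: (cvg_pair ct gl).
  apply: cvgD; last by apply: cJ; exact: cvg_cst.
  apply: cvgB; last exact: cJ.
  apply: cvgB; last by apply: cvg_dot; [exact: cvg_cst|exact: cfst].
  apply: cvg_dot => //.
  by apply: cvgB; [exact: cfst|exact: cvg_cst].
have lt_gap : dot x (q - p) - dot y q - intH H t q + intH H t p < - a - sigma y.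
  by rewrite !dotE; lra.
have near_gap : \forall w \near ((q, (t, x)) : 'rV[R]_n * (R * 'rV[R]_n)),
    gap w < - a - sigma y by exact: (cvgr_lt _ cgap).
apply: filterS near_gap => -[q' z] /= gap_lt [b' qb' /(_ _ _ pa)].
have : dot y q' - sigma y <= b' by rewrite -lee_fin -qb' fenchel_ge.
by move: gap_lt; rewrite /gap /= !dotE; lra.
Qed.

(** The differential is [<dx, p> - dt H(t, p)]. From below, [p] competes at [z]; from above, the
    maximiser [q] at [z] competes at [(t, x)]. The two bounds agree to first order because [q] tends
    to [p]. *)
Lemma unique_max_differentiable t x p : 0 < t < T -> ismax t x p ->
  (forall q, ismax t x q -> q = p) ->
  differentiable (fun z : R * 'rV[R]_n => u z.1 z.2) (t, x).
Proof.
move=> tT /[dup] xp [a pa pmax] puniq.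
have tT' : 0 <= t < T by case/andP: tT => t0 ->; rewrite ltW.
pose L (z : R * 'rV[R]_n) := dot z.2 p - z.1 * H t p.
have linL : linear (L : _ -> R^o).
  move=> c z w; rewrite /L /= !dotE -[c *: (_ : R^o)]/(c * _).
  by rewrite -[c *: z.1]/(c * z.1); ring.
pose L' : {linear (R * 'rV[R]_n)%type -> R^o} :=
  HB.pack L (GRing.isLinear.Build _ _ _ _ L linL).
apply: (differentiable_of_le _ L').
  move=> z; apply: cvgB.
    by apply: cvg_dot; [exact: (@cvg_snd _ _ (nbhs z.1) (nbhs z.2))|exact: cvg_cst].
  by apply: cvgM; [exact: (@cvg_fst _ _ (nbhs z.1) (nbhs z.2))|exact: cvg_cst].
move=> e e0; have e20 : 0 < e / 2 by lra.
have [[U V] /= [tU pV] UV] := intH_strip_derive T H T0 D HD t p _ tT e20.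
have [d /= d0 dV] : exists2 d, 0 < d & forall q, `|q - p| <= d -> V q.
  have [d /= d0 dV] := (iffLR (nbhs_ballP _ _) pV).
  exists (d / 2); first by lra.
  move=> q qp; apply: dV; rewrite -ball_normE /= distrC (le_lt_trans qp)//; lra.
(* The bound [d] brings [q] within reach of the time estimate; the other one makes
   [<z.2 - x, q - p>] cost at most [e / 2] times the distance. *)
have eta0 : 0 < Num.min d (e / 2 / (n%:R + 1)).
  by rewrite lt_min d0 !divr_gt0// ltr_wpDl.
apply: filterS3 (near_strip T t x tT) (near_fst t x U tU)
  (is_max_near t x p _ tT xp puniq eta0) => z zT zU znear.
have [q zq] : exists q, ismax z.1 z.2 q.
  by apply: is_max_exists; case/andP: zT => z0 ->; rewrite ltW.
have := znear q zq; rewrite le_min => /andP[qd qe].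
have [b qb _] := zq.
have zt : `|z.1 - t| <= `|z - (t, x)| by rewrite prod_normE /= le_max lexx.
have zx : `|z.2 - x| <= `|z - (t, x)| by rewrite prod_normE /= le_max lexx orbT.
have lo := hopf_ge _ _ _ _ _ _ _ zq pa.
have hi := hopf_ge _ _ _ _ _ _ _ xp qb.
have zE := hopf_is_max _ _ _ _ _ _ zq qb.
have xE := hopf_is_max _ _ _ _ _ _ xp pa.
have Jp := UV (z.1, p) (conj zU (dV p _)).
have Jq := UV (z.1, q) (conj zU (dV q qd)).
rewrite /= subrr normr0 in Jp; have {}Jp := Jp (ltW d0).
rewrite /= in Jq.
have dotqp : `|dot (z.2 - x) (q - p)| <= e / 2 * `|z - (t, x)|.
  apply: (le_trans (dot_le _ _)); rewrite mulrAC.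
  apply: ler_pM => //.
  have : `|q - p| * (n%:R + 1) <= e / 2 by rewrite -ler_pdivlMr// ltr_wpDl.
  by rewrite mulrDr mulr1 mulrC; have := normr_ge0 (q - p); lra.
have et : e / 2 * `|z.1 - t| <= e / 2 * `|z - (t, x)| by rewrite ler_wpM2l// ltW.
move: Jp Jq dotqp lo hi; rewrite /L /= zE xE !ler_norml !dotE.
move=> /andP[? ?] /andP[? ?] /andP[? ?] ? ?; apply/andP; split; lra.
Qed.


Lemma intH_slice_continuous t : 0 < t < T -> continuous (intH H t).
Proof.
move=> tT p; apply: (cvg_comp (fun q => (t, q)) (fun z => intH H z.1 z.2)
  _ (intH_cvg t p tT)).
by apply: (@cvg_pair _ _ _ (nbhs p) (nbhs t) (nbhs p)); [exact: cvg_cst|exact: cvg_id].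
Qed.

(* [p] minimises [usharp - (intH ts - intH t0) - <x0, .>], where [usharp] is
   the conjugate of [u ts] on a ball around [x0]: the minimality condition says
   that [x] is a subgradient of [usharp] at [p]. This variational argument
   replaces Brouwer's theorem for [x |-> x0 + grad ts p(x) - grad t0 p(x)]. *)
Lemma characteristic_point t0 x0 eps : 0 < t0 < T -> 0 < eps ->
  exists2 delta, 0 < delta & forall ts, t0 < ts -> ts - t0 <= delta ->
    ts < T /\ exists x p, [/\ enorm (x - x0) <= eps,
      x = x0 + (grad ts p - grad t0 p) &
      \forall y \near x, u ts x + dot (y - x) p <= u ts y].
Proof.
move=> t0T eps0; have /andP[t00 t0lt] := t0T.
have t0T' : 0 <= t0 < T by rewrite ltW.
have [r r0 [N N0 hN]] := condA1_is_max _ _ _ t0 x0 A1 t0T'.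
(* Dividing by [n + 1] passes from the sup norm to the Euclidean norm; [r / 2] leaves half of the
   radius in (A1) for the time increment. *)
pose rho := Num.min eps (r / 2) / (n%:R + 1).
have n1 : 0 < (n%:R + 1 : R) by rewrite ltr_wpDl.
have rho0 : 0 < rho by rewrite divr_gt0// lt_min eps0 divr_gt0.
have enorm_rho y : `|y - x0| <= rho -> enorm (y - x0) <= eps /\ enorm (y - x0) <= r / 2.
  move=> yr; apply/andP; rewrite -le_min; apply: (le_trans (enorm_le _)).
  have : `|y - x0| * (n%:R + 1) <= Num.min eps (r / 2) by rewrite -ler_pdivlMr.
  by rewrite mulrDr mulr1 mulrC; have := normr_ge0 (y - x0); lra.
have [d0 [d00 d0r d0T]] : exists d, [/\ 0 < d, d <= r / 4 & d <= (T - t0) / 2].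
  exists (Num.min (r / 4) ((T - t0) / 2)); split; last 2 first.
  - by rewrite ge_min lexx.
  - by rewrite ge_min lexx orbT.
  by rewrite lt_min; apply/andP; split; lra.
have time t : t0 <= t -> t - t0 <= d0 -> 0 <= t /\ t < T.
  by move=> tt0 td; split; lra.
have local t y q : t0 <= t -> t - t0 <= d0 -> `|y - x0| <= rho ->
    ismax t y q -> enorm q <= N.
  move=> tt0 td yr; have [t0' tT] := time t tt0 td.
  apply: (hN t y _ _).2; first by rewrite t0'.
  have [_ yr'] := enorm_rho y yr.
  by rewrite ger0_norm ?subr_ge0//; lra.
have [M M0 hM] := intH_lipschitz_strip T H T0 D HD N.
have J0 q : intH H 0 q = 0 by rewrite /intH set_itv1 Rintegral_set1.
have Jbound t q : t0 <= t -> t - t0 <= d0 -> enorm q <= N -> `|intH H t q| <= M * T.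
  move=> tt0 td qN; have [t0' tT] := time t tt0 td.
  have := hM 0 t q (lexx _) t0' (ltW tT) (le_trans (norm_le_enorm _) qN).
  rewrite J0 !subr0 => /le_trans; apply.
  by rewrite ler_wpM2l// ltW.
pose X := `|x0| + rho.
have X0 : 0 <= X by rewrite addr_ge0// ltW.
have Xle y : `|y - x0| <= rho -> `|y| <= X.
  move=> yr; rewrite -[y](subrK x0) (le_trans (ler_normD _ _))//.
  by rewrite /X addrC lerD2l.
have dotX y q : `|y - x0| <= rho -> enorm q <= N -> `|dot y q| <= n%:R * X * N.
  move=> yr qN; apply: (le_trans (dot_le _ _)); apply: ler_pM => //.
    by rewrite ler_wpM2l// Xle.
  exact: le_trans (norm_le_enorm _) qN.
have [p1 p1max] := is_max_exists t0 x0 t0T'.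
have p1N : enorm p1 <= N.
  by apply: (local _ _ _ (lexx _) _ _ p1max); rewrite subrr ?normr0 ltW.
have [a1 p1a _] := p1max.
(* Bounds [u] near [x0] at all times considered, before [delta] is chosen: [p1] competes from below,
   and [sigma^* >= - sigma 0] bounds from above. *)
pose C := n%:R * X * N + `|sigma 0| + `|a1| + M * T.
have C0 : 0 <= C by rewrite /C !addr_ge0// ?mulr_ge0// ltW.
have ubound t y : t0 <= t -> t - t0 <= d0 -> `|y - x0| <= rho -> `|u t y| <= C.
  move=> tt0 td yr; have [t0' tT] := time t tt0 td.
  have [|q yq] := is_max_exists t y; first by rewrite t0'.
  have qN := local _ _ _ tt0 td yr yq.
  have [b qb _] := yq.
  have lo := hopf_ge _ _ _ _ _ _ _ yq p1a.
  have : - sigma 0 <= b.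
    by have := fenchel_ge sigma q 0; rewrite qb lee_fin dot0l sub0r.
  have uE := hopf_is_max _ _ _ _ _ _ yq qb.
  have := dotX y q yr qN; have := dotX y p1 yr p1N.
  have := Jbound t q tt0 td qN; have := Jbound t p1 tt0 td p1N.
  have := ler_norm (sigma 0); have := ler_norm a1.
  have := normr_ge0 (sigma 0); have := normr_ge0 a1.
  rewrite ler_norml uE in lo *; rewrite !ler_norml /C.
  move=> ? ? ? ? /andP[? ?] /andP[? ?] /andP[? ?] /andP[? ?] ?.
  by apply/andP; split; lra.
(* Forces the minimiser inside the ball: there [psi p] is at least [rho * |p| - C - 1/2], while
   [psi 0] is at most [C + 1/2]. *)
pose N' := (2 * C + 3) / rho.
have N'0 : 0 < N' by rewrite divr_gt0//; lra.
have [M1 M10 hM1] := intH_lipschitz_strip T H T0 D HD N'.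
have [M2 M20 hM2] := gradH_lipschitz T T0 D cD N'.
(* [d0] keeps to the range of (A1), the [M1] term keeps the time integrals below [1 / 2], and the
   [M2] term keeps [x] within [rho / 2] of [x0]. *)
exists (Num.min d0 (Num.min (1 / 2 / M1) (rho / 2 / M2))).
  rewrite !lt_min d00 /=; apply/andP; split; apply: divr_gt0 => //; lra.
move=> ts t0ts; rewrite !le_min => /andP[tsd0 /andP[tsM1 tsM2]].
have [ts0 tsT] := time ts (ltW t0ts) tsd0; split => //.
have tsT' : 0 < ts < T by rewrite (lt_trans t00).
have Wbound q : `|q| <= N' -> `|intH H ts q - intH H t0 q| <= 1 / 2.
  move=> qN; apply: (le_trans (hM1 t0 ts q (ltW t00) (ltW t0ts) (ltW tsT) qN)).
  by rewrite mulrC -ler_pdivlMr.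
pose B := [set y | `|y - x0| <= rho].
have Bx0 : B x0 by rewrite /B /= subrr normr0 ltW.
have uC y : B y -> `|u ts y| <= C by move=> yB; apply: ubound => //; exact: ltW.
pose usharp := conj_on B (u ts).
have usharp_ge : forall y q, B y -> dot y q - u ts y <= usharp q.
  exact: conj_on_ge Xle uC.
have usharp_le : forall q c, (forall y, B y -> dot y q - u ts y <= c) -> usharp q <= c.
  exact: conj_on_le (ex_intro _ x0 Bx0).
pose psi q := usharp q - (intH H ts q - intH H t0 q) - dot x0 q.
have psi_continuous : continuous psi.
  apply: tilted_continuous; try exact: intH_slice_continuous.
  exact: (conj_on_continuous _ _ X C (ex_intro _ x0 Bx0)).
have [||p pK pmin] := @EVT_min_rV R n psi [set q | `|q - 0| <= N'] _
    (norm_ball_compact 0 N').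
- by exists 0; rewrite /= subrr normr0 ltW.
- exact: continuous_subspaceT.
rewrite inE /= subr0 in pK.
have {}pmin q : `|q| <= N' -> psi p <= psi q.
  by move=> qN; apply: pmin; rewrite inE /= subr0.
have pint : `|p| < N'.
  rewrite ltNge; apply/negP => Np.
  (* Testing [usharp p] at [x0 + v], with [v] aligned with [p], yields the growth [rho * |p|]. *)
  have [w w1 pw] := norm_attained p; pose v := rho *: w.
  have vB : B (x0 + v).
    by rewrite /B /= addrAC subrr add0r normrZ (gtr0_norm rho0) ler_piMr// ltW.
  have pv : rho * `|p| <= dot v p by rewrite dotZl ler_pM2l.
  have := pmin 0; rewrite normr0 => /(_ (ltW N'0)).
  have us0 : usharp 0 <= C.
    apply: usharp_le => y yB; rewrite dotC dot0l sub0r.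
    by have := uC y yB; rewrite ler_norml => /andP[? ?]; lra.
  have := usharp_ge _ p vB; have := uC _ vB.
  have := Wbound p pK; have := Wbound 0; rewrite normr0 => /(_ (ltW N'0)).
  have : 2 * C + 3 <= rho * `|p|.
    by rewrite [leRHS]mulrC -ler_pdivrMr.
  rewrite /psi (dotC _ 0) dot0l dotDl !ler_norml.
  by move=> ? /andP[? ?] /andP[? ?] /andP[? ?] ? ?; lra.
have [x xE] : exists x, x = x0 + (grad ts p - grad t0 p) by eexists.
have xr : `|x - x0| <= rho / 2.
  rewrite xE addrAC subrr add0r.
  apply: (le_trans (hM2 t0 ts p (ltW t00) (ltW t0ts) (ltW tsT) pK)).
  by rewrite mulrC -ler_pdivlMr.
have xB : B x by rewrite /B /= (le_trans xr)//; lra.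
(* First-order condition at the interior minimiser, extended to every [q] by convexity of
   [usharp]. *)
have psub q : usharp p + dot x (q - p) <= usharp q.
  pose v := q - p.
  have rd : rderiv (fun s => intH H ts (p + s *: v) - intH H t0 (p + s *: v))
      (dot v (grad ts p) - dot v (grad t0 p)).
    apply: rderivD; last apply: rderivN; apply: (intH_gradH T H T0 D HD cD).
      by rewrite ts0 ltW.
    by rewrite ltW// ltW.
  suff : dot v (grad ts p) - dot v (grad t0 p) <= usharp q - usharp p - dot x0 v.
    by rewrite xE dotDl dotDl dotNl !(dotC _ v); lra.
  apply: rderiv_le rd _.
  have near_int : \forall q' \near p, `|q'| <= N'.
    have pN0 : 0 < N' - `|p| by rewrite subr_gt0.
    apply: filterS (near_dist p _ pN0) => q' q'p; rewrite -(subrK p q').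
    by apply: (le_trans (ler_normD _ _)); lra.
  near=> s.
  have s01 : 0 < s by [].
  have s1 : s <= 1 by near: s; exact: nbhs_right_le.
  have pN : `|p + s *: v| <= N'.
    by near: s; exact: (near0_line p v (fun q' => `|q'| <= N') near_int).
  have := pmin _ pN; rewrite /psi scale0r addr0 dotDr dotZr.
  have : usharp (p + s *: v) <= usharp p + s * (usharp q - usharp p).
    apply: usharp_le => y yB; have := usharp_ge y p yB; have := usharp_ge y q yB.
    by rewrite /v !dotE; nra.
  by lra.
exists x, p; split => //; first exact: (enorm_rho x xB).1.
have tsT2 : 0 <= ts < T by rewrite ts0.
(* Return from [usharp] to [u ts]: a maximiser [q] at [x] attains Fenchel equality there, and
   comparing [p] with [q] through [psub] gives it for [p] too. *)
have [q xq] := is_max_exists ts x tsT2.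
have sub y := is_max_subgrad ts x y q tsT2 xq.
have usq : usharp q <= dot x q - u ts x.
  apply: usharp_le => y yB; have := sub y.
  by rewrite !dotE; lra.
have near_x : \forall y \near x, `|y - x| <= rho / 2.
  by apply: filterS (near_dist x (rho / 2) _) => [y /ltW//|]; lra.
apply: filterS near_x => y yx.
have yB : B y.
  rewrite /B /= -(subrK x y) -addrA (le_trans (ler_normD _ _))//.
  by rewrite [leRHS]splitr lerD.
have := psub q; have := usharp_ge y p yB.
by rewrite !dotE; lra.
Unshelve. all: by end_near. Qed.

Lemma singular_propagates t0 x0 eps : singular T u t0 x0 -> 0 < eps ->
  exists delta, 0 < delta /\ forall ts, t0 < ts -> `|ts - t0| <= delta ->
    exists xs, enorm (xs - x0) <= eps /\ singular T u ts xs.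
Proof.
move=> [t0T nd] eps0; have /andP[t00 t0lt] := t0T.
have [d d0 hd] := characteristic_point t0 x0 eps t0T eps0.
exists d; split => // ts t0ts; rewrite gtr0_norm ?subr_gt0// => tsd.
have [tsT [x [p [xe xE psub]]]] := hd ts t0ts tsd.
have ts0 : 0 < ts by exact: lt_trans t0ts.
exists x; split => //; split; first by rewrite ts0.
move=> df; apply: nd.
have tsT' : 0 <= ts < T by rewrite ltW.
(* [p] and all maximisers are subgradients of [u ts] at [x], so the differential identifies them;
   since a maximiser exists, [p] is one. *)
have uniq q : ismax ts x q -> q = p.
  move=> xq; apply: dot_eqP => v; rewrite (diff_subgrad _ _ _ _ df psub).
  apply: (diff_subgrad _ _ _ _ df); apply: filterE => y.
  exact: is_max_subgrad.
have [q xq] := is_max_exists ts x tsT'.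
have xp : ismax ts x p by rewrite -(uniq q xq).
have [] := is_max_backward t0 ts x p (ltW t00) (ltW t0ts) tsT xp uniq.
have -> : x - grad ts p + grad t0 p = x0.
  by rewrite xE -addrA [- grad ts p + _]addrC -(opprB (grad ts p)) addrK.
exact: unique_max_differentiable.
Qed.

End Hopf.

Theorem theorem3p4 (R : realType) (n : nat) (T : R)
    (H : R -> 'rV[R]_n -> R) (sigma : 'rV[R]_n -> R)
    (hT : 0 < T)
    (hH : C1_on [set z : R * 'rV[R]_n | 0 <= z.1 <= T]
                (fun z : R * 'rV[R]_n => H z.1 z.2))
    (hsigma_convex : convex_function [set: 'rV[R]_n] sigma)
    (hsigma_C1 : C1_on [set: 'rV[R]_n] sigma)
    (hA1 : condA1 T sigma H)
    (hA2 : condA2 T H)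
    (t0 : R) (x0 : 'rV[R]_n)
    (hsing : singular T (hopf sigma H) t0 x0) :
  forall eps : R, 0 < eps ->
  exists delta : R, 0 < delta /\
    forall ts : R, t0 < ts -> `|ts - t0| <= delta ->
    exists xs : 'rV[R]_n,
      enorm (xs - x0) <= eps /\ singular T (hopf sigma H) ts xs.
Proof.
have [D [HD cD]] := hH.
move=> eps; exact: (singular_propagates T H sigma hT D HD cD hsigma_convex
  hsigma_C1 hA1 hA2 t0 x0 eps hsing).
Qed.
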